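(* Let $\ell$ be a positive integer. For $n\ge 1$ define the modified Nörlund polynomials $$B_n^{(\ell)*}=\sum_{r=0}^{n}\binom{n+r}{2r}\frac{B_r^{(\ell)}}{n+r},$$ where $B_r^{(\ell)}$ are the Nörlund polynomials given by $\sum_{r\ge0}B_r^{(\ell)}\frac{z^r}{r!}=\left(\frac{z}{e^z-1}\right)^{\ell}$. Then the generating function $F_{B^*}(z;\ell)=\sum_{n=1}^{\infty}B_n^{(\ell)*}z^n$, viewed as a formal power series in $z$ (with the right-hand side below understood through its expansion as $z\to0^+$), is given by $$F_{B^*}(z;\ell) = -\frac12\log z + \frac12\left[H_{\ell-1} - \frac{d^{\ell-1}}{dx^{\ell-1}}\left\{\binom{x-1}{\ell-1}\psi\!\left(x-\left\lfloor\tfrac{\ell}{2}\right\rfloor\right)\right\}\right]\Bigg|_{x=z+1/z+\ell-2}.$$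
   Context: $H_n$ is the $n$-th harmonic number ($H_0=0$), $\psi=\Gamma'/\Gamma$ is the digamma function, and $\binom{x}{n}=\frac{x(x-1)\cdots(x-n+1)}{n!}$ is the generalized binomial coefficient. *)

(* Defs.v *)
From Stdlib Require Import Reals Factorial Binomial.
From Coquelicot Require Import Coquelicot.
Open Scope R_scope.

Definition Gamma (x : R) : R :=
  RInt_gen (fun t => Rpower t (x - 1) * exp (- t))
           (at_right 0) (Rbar_locally p_infty).

Definition digamma (x : R) : R := Derive Gamma x / Gamma x.

Fixpoint harmonic (n : nat) : R :=
  match n with
  | O => 0
  | S m => harmonic m + / INR (S m)
  end.

Fixpoint falling (x : R) (n : nat) : R :=
  match n with
  | O => 1
  | S m => falling x m * (x - INR m)
  end.
Definition gbinom (x : R) (n : nat) : R := falling x n / INR (Factorial.fact n).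

Definition bern_gen (z : R) : R :=
  if Req_EM_T z 0 then 1 else z / (exp z - 1).

(* Norlund polynomial B_r^(l): r! times the r-th Taylor coefficient at 0 of
   (z/(e^z-1))^l, i.e. the r-th derivative at 0. *)
Definition norlund (l r : nat) : R :=
  Derive_n (fun z => (bern_gen z) ^ l) r 0.

Definition norlund_star (l n : nat) : R :=
  sum_f_R0 (fun r => Binomial.C (n + r) (2 * r) * norlund l r / INR (n + r)) n.

Definition FBstar_partial (l N : nat) (z : R) : R :=
  sum_f_R0 (fun n => match n with O => 0 | _ => norlund_star l n * z ^ n end) N.

Definition FBstar_rhs (l : nat) (z : R) : R :=
  - / 2 * ln z
  + / 2 * (harmonic (l - 1)
           - Derive_n (fun x => gbinom (x - 1) (l - 1) * digamma (x - INR (Nat.div l 2)))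
                      (l - 1) (z + / z + INR l - 2)).

(* Main.v *)
Require Import Defs.
From Stdlib Require Import Reals.
From Coquelicot Require Import Coquelicot.
From Stdlib Require Import Lra Lia Factorial Binomial.
Open Scope R_scope.

(* Let beta(t) = t / (e^t - 1) and y = x - l. For y large, there is the exact formula
     d^(l-1)/dx^(l-1) { binom(x-1, l-1) psi(x - floor(l/2)) }
       = ln y + H_(l-1) - int_0^oo (beta(t)^l - 1) / t * e^(-y t) dt.
   For l = 1 this is Binet's formula for psi(y + 1): both sides satisfy the difference
   equation of psi and are ln y + O(1/y). The case of general l follows by multiplying by one
   linear factor of the binomial coefficient at a time: D^l ((x - c) g) = (x - c) D^l g
   + l D^(l-1) g, and multiplication by y is an integration by parts under the integral.
   Taylor-expanding beta^l (Watson's lemma) turns the integral into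
   - sum_r B_r^(l) / (r y^r); at y = z + 1/z - 2 = (1 - z)^2 / z one has
   ln z + ln y = 2 ln (1 - z) and y^(-r) = z^r (1 - z)^(-2r), whose binomial series
   produce the coefficients of the modified polynomials. *)

(** The exact formula holds with floor(l/2) replaced by any b with 0 <= b <= l-1. Passing from b to
    b+1 changes psi(x - b) by 1/(x - b - 1); the binomial coefficient contains the factor x - b - 1,
    so the product changes by a polynomial of degree l-2, which the derivative of order l-1 kills.
    Accordingly the induction starts from psi(v) and adjoins b factors from v upwards and a factors
    below v. A factor above keeps y; a factor below moves y to y - 1, so that step also needs the
    difference equation in y. Gamma is given only as an improper integral, so psi is reached through
    integrals as well: psi(x) is the mean of ln t for the density t^(x-1) e^(-t) / Gamma(x), and
    tangent lines of ln give ln(x-1) <= psi(x) <= ln x. Arguments are kept large, where the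
    integrands are bounded at 0 and dominated by one exponential; a single differentiation lemma
    then serves both Gamma and the Laplace transforms. *)

(** * Elementary estimates *)

Lemma ball_Rabs (x e y : R) : ball x e y -> Rabs (y - x) < e.
Proof. exact (fun H => H). Qed.

(** Stands in for dominated convergence: differentiation under the integral produces exactly such a
    quadratic remainder. *)
Lemma is_derive_of_quadratic_bound (F : R -> R) (x l delta C : R) :
  0 < delta ->
  (forall h, Rabs h < delta -> Rabs (F (x + h) - F x - h * l) <= C * h ^ 2) ->
  is_derive F x l.
Proof.
  intros Hd H. apply is_derive_Reals. intros eps Heps.
  set (d := Rmin delta (eps / (Rabs C + 1))).
  assert (HC : 0 <= Rabs C) by apply Rabs_pos.
  assert (Hd' : 0 < d) by (apply Rmin_pos; [lra | apply Rdiv_lt_0_compat; lra]).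
  exists (mkposreal d Hd'). intros h Hh0 Hh. simpl in Hh.
  assert (Hh1 : Rabs h < delta) by (eapply Rlt_le_trans; [exact Hh | apply Rmin_l]).
  assert (Hh2 : Rabs h < eps / (Rabs C + 1))
    by (eapply Rlt_le_trans; [exact Hh | apply Rmin_r]).
  assert (Hp : 0 < Rabs h) by (apply Rabs_pos_lt; auto).
  replace ((F (x + h) - F x) / h - l) with ((F (x + h) - F x - h * l) * / h)
    by (field; auto).
  rewrite Rabs_mult, Rabs_inv.
  apply (Rmult_lt_reg_r (Rabs h)); auto.
  rewrite Rmult_assoc, Rinv_l, Rmult_1_r by lra.
  eapply Rle_lt_trans; [apply H; auto |].
  rewrite <- pow2_abs.
  assert (Hb : (Rabs C + 1) * Rabs h < eps).
  { apply (Rmult_lt_compat_l (Rabs C + 1)) in Hh2; [|lra].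
    replace ((Rabs C + 1) * (eps / (Rabs C + 1))) with eps in Hh2 by (field; lra).
    exact Hh2. }
  pose proof (Rle_abs C). nra.
Qed.

(** [e^u >= 1 + u] at [u = v] and [u = -v] squeezes the remainder between 0 and [v (e^v - 1)]. *)
Lemma exp_taylor1_bound (v : R) : Rabs (exp v - 1 - v) <= v ^ 2 * exp (Rabs v).
Proof.
  pose proof (exp_ineq1_le v) as H1.
  pose proof (exp_ineq1_le (- v)) as H2.
  rewrite exp_Ropp in H2.
  pose proof (exp_pos v) as Hp.
  assert (H3 : exp v - 1 <= v * exp v).
  { apply (Rmult_le_compat_l (exp v)) in H2; [|lra].
    rewrite Rinv_r in H2 by lra. lra. }
  rewrite Rabs_right by lra.
  destruct (Rle_dec 0 v).
  - rewrite (Rabs_right v) by lra. nra.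
  - rewrite (Rabs_left v) by lra.
    assert (1 <= exp (- v)) by (pose proof (exp_ineq1_le (- v)); lra).
    assert (v * exp v <= v * (1 + v)) by nra. nra.
Qed.

Lemma sqr_le_exp (s : R) : 0 <= s -> s ^ 2 <= 4 * exp s.
Proof.
  intros Hs. replace (exp s) with (exp (s / 2) * exp (s / 2))
    by (rewrite <- exp_plus; f_equal; lra).
  pose proof (exp_ineq1_le (s / 2)). nra.
Qed.

Lemma exp_Rabs_le (d v : R) : 0 <= d -> exp (d * Rabs v) <= exp (d * v) + exp (- (d * v)).
Proof.
  intros Hd. pose proof (exp_pos (d * v)). pose proof (exp_pos (- (d * v))).
  unfold Rabs; destruct (Rcase_abs v).
  - replace (d * - v) with (- (d * v)) by ring. lra.
  - lra.
Qed.

Lemma exp_le (a b : R) : a <= b -> exp a <= exp b.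
Proof. intros [H|H]; [left; now apply exp_increasing | rewrite H; lra]. Qed.

(** * Improper integrals over the positive half-line *)

(** Uses the same two filters as [Gamma], so [Gamma x] is by conversion a [pint]. *)
Definition is_pint (f : R -> R) (l : R) : Prop :=
  is_RInt_gen f (at_right 0) (Rbar_locally p_infty) l.

Definition pint (f : R -> R) : R := RInt_gen f (at_right 0) (Rbar_locally p_infty).

(** Forces boundedness at 0 as well as decay at infinity, so no singularity at 0 ever has to be
    treated. *)
Definition expdom (f : R -> R) : Prop :=
  (forall t, 0 < t -> continuous f t) /\
  exists C c, 0 < c /\ forall t, 0 < t -> Rabs (f t) <= C * exp (- (c * t)).

Lemma pint_unique (f : R -> R) (l : R) : is_pint f l -> pint f = l.
Proof.
  exact (is_RInt_gen_unique (V := R_CompleteNormedModule) (Fa := at_right 0)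
           (Fb := Rbar_locally p_infty) f l).
Qed.

Lemma filter_pos_le :
  filter_prod (at_right 0) (Rbar_locally p_infty)
    (fun ab : R * R => 0 < fst ab <= snd ab).
Proof.
  exists (fun a => 0 < a < 1) (fun b => 1 < b).
  - exists (mkposreal 1 Rlt_0_1). intros y Hy Hy0.
    apply ball_Rabs in Hy; simpl in Hy.
    rewrite Rminus_0_r, Rabs_right in Hy by lra. lra.
  - exists 1. auto.
  - intros a b Ha Hb; simpl; lra.
Qed.

Lemma is_pint_ext (f g : R -> R) (l : R) :
  (forall t, 0 < t -> f t = g t) -> is_pint f l -> is_pint g l.
Proof.
  intros H.
  apply (is_RInt_gen_ext (V := R_NormedModule) (Fa := at_right 0)
           (Fb := Rbar_locally p_infty) f g l).
  eapply filter_imp; [|exact filter_pos_le].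
  intros [a b] Hab x Hx; simpl in *.
  rewrite Rmin_left in Hx by lra. apply H; lra.
Qed.

Lemma is_pint_Derive (f df : R -> R) (la lb : R) :
  (forall t, 0 < t -> is_derive f t (df t)) ->
  (forall t, 0 < t -> continuous df t) ->
  filterlim f (at_right 0) (locally la) ->
  filterlim f (Rbar_locally p_infty) (locally lb) ->
  is_pint df (lb - la).
Proof.
  intros Hd Hc Ha Hb.
  apply (is_pint_ext (Derive f)).
  { intros t Ht. apply is_derive_unique. auto. }
  apply (is_RInt_gen_Derive (Fa := at_right 0) (Fb := Rbar_locally p_infty) f la lb);
    [| | exact Ha | exact Hb].
  - eapply filter_imp; [|exact filter_pos_le].
    intros [a b] Hab x Hx; simpl in *. rewrite Rmin_left in Hx by lra.
    exists (df x). apply Hd; lra.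
  - eapply filter_imp; [|exact filter_pos_le].
    intros [a b] Hab x Hx; simpl in *. rewrite Rmin_left in Hx by lra.
    apply (continuous_ext_loc (Derive f) df).
    + assert (Hx0 : 0 < x) by lra.
      exists (mkposreal x Hx0). intros y Hy.
      apply ball_Rabs in Hy; simpl in Hy.
      apply Rabs_def2 in Hy. symmetry. apply is_derive_unique, Hd. lra.
    + apply Hc; lra.
Qed.

Lemma filterlim_le_exp (f : R -> R) (C c : R) :
  0 < c -> (forall t, 0 < t -> Rabs (f t) <= C * exp (- (c * t))) ->
  filterlim f (Rbar_locally p_infty) (locally 0).
Proof.
  intros Hc H.
  apply filterlim_locally. intros eps. destruct eps as [e He].
  (* Beyond this point [|C| < e c t <= e exp (c t)]; the 1 keeps [t] positive. *)
  exists (Rmax 1 (Rabs C / (c * e))). intros t Ht.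
  assert (H1 : 1 < t) by (eapply Rle_lt_trans; [apply Rmax_l | exact Ht]).
  assert (H2 : Rabs C / (c * e) < t) by (eapply Rle_lt_trans; [apply Rmax_r | exact Ht]).
  unfold ball; simpl; unfold AbsRing_ball, abs, minus, plus, opp; simpl.
  rewrite Ropp_0, Rplus_0_r.
  eapply Rle_lt_trans; [apply H; lra |].
  rewrite exp_Ropp.
  pose proof (exp_ineq1_le (c * t)) as He1.
  assert (Hct : 0 < c * t) by (apply Rmult_lt_0_compat; lra).
  apply (Rmult_lt_reg_r (exp (c * t))); [apply exp_pos |].
  rewrite Rmult_assoc, Rinv_l, Rmult_1_r by (pose proof (exp_pos (c * t)); lra).
  apply (Rmult_lt_compat_l (c * e)) in H2; [|apply Rmult_lt_0_compat; lra].
  replace (c * e * (Rabs C / (c * e))) with (Rabs C) in H2 by (field; lra).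
  pose proof (Rle_abs C). nra.
Qed.

Lemma continuous_at_right (f : R -> R) (x : R) :
  continuous f x -> filterlim f (at_right x) (locally (f x)).
Proof.
  intros H. eapply filterlim_filter_le_1; [|exact H].
  apply filter_le_within.
Qed.

Lemma is_pint_exp (c : R) : 0 < c -> is_pint (fun t => exp (- (c * t))) (/ c).
Proof.
  intros Hc.
  replace (/ c) with (0 - (- (/ c) * exp (- (c * 0))))
    by (rewrite Rmult_0_r, Ropp_0, exp_0; lra).
  apply (is_pint_Derive (fun t => - (/ c) * exp (- (c * t)))).
  - intros t _. auto_derive; auto. field. lra.
  - intros t _. apply (ex_derive_continuous (fun t => exp (- (c * t)))). auto_derive; auto.
  - apply (continuous_at_right (fun t => - / c * exp (- (c * t)))).
    apply (ex_derive_continuous (fun t => - / c * exp (- (c * t)))). auto_derive; auto.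
  - apply (filterlim_le_exp _ (/ c) c Hc).
    intros t _. rewrite Rabs_mult, Rabs_Ropp, !Rabs_right; try lra.
    + apply Rle_ge, Rlt_le, exp_pos.
    + apply Rle_ge, Rlt_le, Rinv_0_lt_compat, Hc.
Qed.

Lemma ex_RInt_pos (f : R -> R) (a b : R) :
  (forall t, 0 < t -> continuous f t) -> 0 < a -> 0 < b -> ex_RInt f a b.
Proof.
  intros Hc Ha Hb. apply (ex_RInt_continuous (V := R_CompleteNormedModule)).
  intros z Hz. apply Hc. assert (0 < Rmin a b) by (apply Rmin_pos; auto). lra.
Qed.

(** The integrals over [[a,b]] grow with the interval and stay below [C / c], hence converge to
    their supremum. *)
Lemma ex_pint_nonneg (f : R -> R) (C c : R) :
  0 < c -> (forall t, 0 < t -> continuous f t) ->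
  (forall t, 0 < t -> 0 <= f t <= C * exp (- (c * t))) ->
  exists l, is_pint f l.
Proof.
  intros Hc Hcont Hf.
  set (E := fun s => exists a b, 0 < a /\ a <= b /\ s = RInt f a b).
  assert (HC : 0 <= C).
  { specialize (Hf 1 Rlt_0_1). pose proof (exp_pos (- (c * 1))). nra. }
  assert (Hex : forall a b, 0 < a -> 0 < b -> ex_RInt f a b)
    by (intros; apply ex_RInt_pos; auto).
  assert (Hnn : forall a b, 0 < a -> a <= b -> 0 <= RInt f a b).
  { intros a b Ha Hb. apply RInt_ge_0; auto. apply Hex; lra.
    intros x Hx; apply Hf; lra. }
  assert (Hbd : is_upper_bound E (C / c)).
  { intros s (a & b & Ha & Hb & ->).
    set (g := fun t => - (C / c) * exp (- (c * t))).
    assert (Hg : is_RInt (fun t => C * exp (- (c * t))) a b (g b - g a)).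
    { apply (is_RInt_derive g).
      - intros x _. unfold g. auto_derive; auto. field; lra.
      - intros x _. apply (ex_derive_continuous (fun t => C * exp (- (c * t)))).
        auto_derive; auto. }
    apply Rle_trans with (g b - g a).
    - rewrite <- (is_RInt_unique _ _ _ _ Hg).
      apply RInt_le; auto. apply Hex; lra. eexists; exact Hg.
      intros x Hx; apply Hf; lra.
    - unfold g. pose proof (exp_pos (- (c * b))).
      assert (exp (- (c * a)) <= 1).
      { rewrite <- exp_0. apply exp_le. nra. }
      assert (0 <= C / c) by (apply Rdiv_le_0_compat; lra). nra. }
  destruct (completeness E) as [S [HS1 HS2]].
  { exists (C / c). exact Hbd. }
  { exists (RInt f 1 1). exists 1, 1. repeat split; lra. }
  exists S. intros P [eps HP].
  (* One interval comes within [eps] of the supremum; every larger interval then does too. *)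
  assert (Ha0 : exists a0 b0, 0 < a0 /\ a0 <= b0 /\ S - eps < RInt f a0 b0).
  { apply Classical_Prop.NNPP. intros Hn.
    assert (S <= S - eps).
    { apply HS2. intros s (a & b & Ha & Hb & ->).
      apply Rnot_lt_le. intros Hlt. apply Hn. exists a, b. auto. }
    pose proof (cond_pos eps). lra. }
  destruct Ha0 as (a0 & b0 & Ha0 & Hb0 & Hlt).
  exists (fun a => 0 < a < a0) (fun b => b0 < b).
  - exists (mkposreal a0 Ha0). intros y Hy Hy0.
    apply ball_Rabs in Hy; simpl in Hy.
    rewrite Rminus_0_r, Rabs_right in Hy by lra. lra.
  - exists b0. auto.
  - intros a b Ha Hb. exists (RInt f a b). split.
    + apply (RInt_correct (V := R_CompleteNormedModule)). apply Hex; simpl; lra.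
    + apply HP. unfold ball; simpl; unfold AbsRing_ball, abs, minus, plus, opp; simpl.
      assert (RInt f a b <= S) by (apply HS1; exists a, b; repeat split; lra).
      assert (RInt f a0 b0 <= RInt f a b).
      { rewrite <- (RInt_Chasles f a a0 b), <- (RInt_Chasles f a0 b0 b);
          try (apply Hex; lra).
        unfold plus; simpl.
        pose proof (Hnn a a0). pose proof (Hnn b0 b). lra. }
      apply Rabs_def1; lra.
Qed.

(** With [g] the dominating exponential, [f + g] lies between 0 and [2 g]; integrate it and subtract
    [g]. *)
Lemma ex_pint (f : R -> R) : expdom f -> is_pint f (pint f).
Proof.
  intros [Hc (C & c & Hc0 & Hb)].
  set (g := fun t => C * exp (- (c * t))).
  assert (Hg : forall t, continuous g t).
  { intros t. apply (ex_derive_continuous g). unfold g. auto_derive; auto. }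
  destruct (ex_pint_nonneg (fun t => f t + g t) (2 * C) c) as [l Hl]; auto.
  { intros t Ht. apply (continuous_plus f g); auto. }
  { intros t Ht. specialize (Hb t Ht). apply Rabs_le_between in Hb. unfold g. lra. }
  assert (H : is_pint f (l - C * / c)).
  { apply (is_pint_ext (fun t => (f t + g t) - g t)).
    { intros; ring. }
    apply (is_RInt_gen_minus (fun t => f t + g t) g l (C * / c)); auto.
    apply (is_RInt_gen_scal (fun t => exp (- (c * t))) C (/ c)).
    now apply is_pint_exp. }
  now rewrite (pint_unique _ _ H).
Qed.

Lemma is_pint_plus (f g : R -> R) (lf lg : R) :
  is_pint f lf -> is_pint g lg -> is_pint (fun t => f t + g t) (lf + lg).
Proof. intros; now apply (is_RInt_gen_plus f g lf lg). Qed.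

Lemma is_pint_scal (k : R) (f : R -> R) (l : R) :
  is_pint f l -> is_pint (fun t => k * f t) (k * l).
Proof. intros; now apply (is_RInt_gen_scal f k l). Qed.

Lemma is_pint_minus (f g : R -> R) (lf lg : R) :
  is_pint f lf -> is_pint g lg -> is_pint (fun t => f t - g t) (lf - lg).
Proof. intros; now apply (is_RInt_gen_minus f g lf lg). Qed.

Lemma is_pint_abs_le (f g : R -> R) (lf lg : R) :
  (forall t, 0 < t -> Rabs (f t) <= g t) ->
  is_pint f lf -> is_pint g lg -> Rabs lf <= lg.
Proof.
  intros H Hf Hg.
  apply (RInt_gen_norm (V := R_CompleteNormedModule) (Fa := at_right 0)
           (Fb := Rbar_locally p_infty) f g lf lg); auto.
  - eapply filter_imp; [|exact filter_pos_le]. intros [a b]; simpl; lra.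
  - eapply filter_imp; [|exact filter_pos_le]. intros [a b] Hab x Hx; simpl in *.
    apply H; lra.
Qed.

Lemma is_pint_ge0 (f : R -> R) (l : R) :
  (forall t, 0 < t -> 0 <= f t) -> is_pint f l -> 0 <= l.
Proof.
  intros H Hf.
  apply Rle_trans with (Rabs l); [apply Rabs_pos |].
  apply (is_pint_abs_le f f); auto. intros t Ht. rewrite Rabs_right; auto.
  lra. apply Rle_ge; auto.
Qed.

Lemma is_pint_le (f g : R -> R) (lf lg : R) :
  (forall t, 0 < t -> f t <= g t) -> is_pint f lf -> is_pint g lg -> lf <= lg.
Proof.
  intros H Hf Hg.
  assert (0 <= lg - lf); [|lra].
  apply (is_pint_ge0 (fun t => g t - f t)).
  - intros t Ht. specialize (H t Ht). lra.
  - now apply is_pint_minus.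
Qed.

Lemma expdom_le (f g : R -> R) (k : R) :
  (forall t, 0 < t -> continuous f t) -> expdom g ->
  (forall t, 0 < t -> Rabs (f t) <= k * Rabs (g t)) -> 0 <= k -> expdom f.
Proof.
  intros Hf [_ (C & c & Hc & Hb)] Hle Hk. split; auto.
  exists (k * C), c. split; auto. intros t Ht.
  eapply Rle_trans; [apply Hle; auto |]. specialize (Hb t Ht).
  rewrite Rmult_assoc. apply Rmult_le_compat_l; auto.
Qed.

Lemma expdom_plus (f g : R -> R) :
  expdom f -> expdom g -> expdom (fun t => f t + g t).
Proof.
  intros [Hf (C & c & Hc & Hb)] [Hg (C' & c' & Hc' & Hb')]. split.
  { intros t Ht. apply (continuous_plus f g); auto. }
  exists (Rabs C + Rabs C'), (Rmin c c'). split; [now apply Rmin_pos |].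
  intros t Ht. eapply Rle_trans; [apply Rabs_triang |].
  specialize (Hb t Ht). specialize (Hb' t Ht).
  assert (exp (- (c * t)) <= exp (- (Rmin c c' * t))).
  { apply exp_le. pose proof (Rmin_l c c'). nra. }
  assert (exp (- (c' * t)) <= exp (- (Rmin c c' * t))).
  { apply exp_le. pose proof (Rmin_r c c'). nra. }
  pose proof (exp_pos (- (c * t))). pose proof (exp_pos (- (c' * t))).
  pose proof (Rle_abs C). pose proof (Rle_abs C').
  pose proof (Rabs_pos C). pose proof (Rabs_pos C'). nra.
Qed.

(** * Differentiation under the integral sign *)

(** Families [x -> int e^(x u(t)) w(t) dt]: [u = ln] gives Gamma, [u = -t] the Laplace transform.
    The open range [x0 < x] leaves room for the exponents [x + d] and [x - d]. *)
Definition admissible (u : R -> R) (x0 : R) (w : R -> R) : Prop :=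
  (forall t, 0 < t -> continuous u t) /\ (forall t, 0 < t -> continuous w t) /\
  forall x, x0 < x -> expdom (fun t => exp (x * u t) * w t).

Lemma continuous_exp_mul (u w : R -> R) (x t : R) :
  continuous u t -> continuous w t -> continuous (fun t => exp (x * u t) * w t) t.
Proof.
  intros Hu Hw. apply (continuous_mult (fun t => exp (x * u t)) w); auto.
  apply (continuous_comp (fun t => x * u t) exp).
  - apply (continuous_mult (fun _ => x) u); auto. apply continuous_const.
  - apply (ex_derive_continuous exp). auto_derive; auto.
Qed.

(** A factor [e^(d |u|)] is at most [e^(d u) + e^(-d u)], which shifts [x] to two other admissible
    exponents. *)
Lemma expdom_Rabs_exp (u w : R -> R) (x0 x d : R) :
  admissible u x0 w -> 0 <= d -> x0 < x - d ->
  expdom (fun t => exp (x * u t) * exp (d * Rabs (u t)) * Rabs (w t)).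
Proof.
  intros (Hu & Hw & He) Hd Hx.
  assert (Ha : forall y, x0 < y -> expdom (fun t => exp (y * u t) * Rabs (w t))).
  { intros y Hy. eapply (expdom_le _ _ 1); [|apply (He y Hy)| |lra].
    - intros t Ht. apply continuous_exp_mul; auto.
      apply (continuous_comp w Rabs); auto. apply continuous_Rabs.
    - intros t Ht. rewrite !Rabs_mult, Rabs_Rabsolu. lra. }
  eapply (expdom_le _ _ 1);
    [| apply (expdom_plus _ _ (Ha (x + d) ltac:(lra)) (Ha (x - d) ltac:(lra))) | | lra].
  - intros t Ht.
    apply (continuous_mult (fun t => exp (x * u t) * exp (d * Rabs (u t)))).
    + apply continuous_exp_mul; auto.
      apply (continuous_comp (fun t => d * Rabs (u t)) exp).
      * apply (continuous_mult (fun _ => d)). apply continuous_const.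
        apply (continuous_comp u Rabs); auto. apply continuous_Rabs.
      * apply (ex_derive_continuous exp). auto_derive; auto.
    + apply (continuous_comp w Rabs); auto. apply continuous_Rabs.
  - intros t Ht. rewrite Rmult_1_l, <- Rmult_plus_distr_r, !Rabs_mult, Rabs_Rabsolu.
    apply Rmult_le_compat_r; [apply Rabs_pos |].
    pose proof (exp_pos (x * u t)). pose proof (exp_pos (d * Rabs (u t))).
    pose proof (exp_pos ((x + d) * u t)). pose proof (exp_pos ((x - d) * u t)).
    rewrite !(Rabs_right (exp _)), (Rabs_right (_ + _)) by lra.
    pose proof (exp_Rabs_le d (u t) Hd) as H3.
    apply (Rmult_le_compat_l (exp (x * u t))) in H3; [|lra].
    eapply Rle_trans; [exact H3 |].
    rewrite Rmult_plus_distr_l, <- !exp_plus. right.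
    f_equal; apply f_equal; ring.
Qed.

(** [|u| <= e^(d |u|) / d], so the factor created by a differentiation is absorbed and the lemma can
    be iterated. *)
Lemma admissible_mul (u w : R -> R) (x0 : R) :
  admissible u x0 w -> admissible u x0 (fun t => u t * w t).
Proof.
  intros Hadm. pose proof Hadm as (Hu & Hw & He).
  assert (Hc : forall t, 0 < t -> continuous (fun t => u t * w t) t).
  { intros t Ht. apply (continuous_mult u w); auto. }
  split; [|split]; auto. intros x Hx.
  set (d := (x - x0) / 2). assert (Hd : 0 < d) by (unfold d; lra).
  eapply (expdom_le _ _ (/ d)).
  - intros t Ht. apply continuous_exp_mul; auto.
  - apply (expdom_Rabs_exp u w x0 x d); auto; unfold d; lra.
  - intros t Ht. rewrite !Rabs_mult, Rabs_Rabsolu.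
    pose proof (exp_pos (x * u t)). pose proof (exp_pos (d * Rabs (u t))).
    rewrite !(Rabs_right (exp _)) by lra.
    pose proof (exp_ineq1_le (d * Rabs (u t))).
    replace (/ d * (exp (x * u t) * exp (d * Rabs (u t)) * Rabs (w t)))
      with (exp (x * u t) * (/ d * exp (d * Rabs (u t)) * Rabs (w t))) by ring.
    apply Rmult_le_compat_l; [lra|]. apply Rmult_le_compat_r; [apply Rabs_pos |].
    apply (Rmult_le_reg_l d); auto. rewrite <- Rmult_assoc, Rinv_r by lra. lra.
  - left. now apply Rinv_0_lt_compat.
Qed.

Lemma is_derive_pint (u w : R -> R) (x0 x : R) :
  admissible u x0 w -> x0 < x ->
  is_derive (fun x => pint (fun t => exp (x * u t) * w t)) x
    (pint (fun t => exp (x * u t) * (u t * w t))).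
Proof.
  intros Hadm Hx. pose proof Hadm as (Hu & Hw & He).
  pose proof (admissible_mul u w x0 Hadm) as (_ & _ & He').
  (* The remainder costs [e^(d |u|)] twice, once for [e^(|h| |u|)] and once for
     [u^2 <= 4 / d^2 * e^(d |u|)]; a quarter of the gap keeps [x - 2 d] above [x0]. *)
  set (d := (x - x0) / 4). assert (Hd : 0 < d) by (unfold d; lra).
  pose proof (expdom_Rabs_exp u w x0 x (2 * d) Hadm ltac:(lra) ltac:(unfold d; lra)) as HK.
  set (K := fun t => exp (x * u t) * exp (2 * d * Rabs (u t)) * Rabs (w t)) in HK.
  apply (is_derive_of_quadratic_bound _ _ _ d (4 / d ^ 2 * pint K)); auto.
  intros h Hh.
  assert (Hxh : x0 < x + h) by (apply Rabs_def2 in Hh; unfold d in Hh; lra).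
  replace (4 / d ^ 2 * pint K * h ^ 2) with ((4 / d ^ 2 * h ^ 2) * pint K) by ring.
  eapply is_pint_abs_le; [| |apply is_pint_scal, ex_pint, HK].
  2: { apply is_pint_minus; [apply is_pint_minus; apply ex_pint; auto |].
       apply is_pint_scal, ex_pint; auto. }
  intros t Ht. unfold K.
  replace (exp ((x + h) * u t) * w t - exp (x * u t) * w t
           - h * (exp (x * u t) * (u t * w t)))
    with (exp (x * u t) * (exp (h * u t) - 1 - h * u t) * w t).
  2: { rewrite Rmult_plus_distr_r, exp_plus. ring. }
  rewrite !Rabs_mult, (Rabs_right (exp _)) by (apply Rle_ge, Rlt_le, exp_pos).
  rewrite <- !Rmult_assoc. apply Rmult_le_compat_r; [apply Rabs_pos |].
  rewrite (Rmult_comm _ (exp (x * u t))), !Rmult_assoc.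
  apply Rmult_le_compat_l; [apply Rlt_le, exp_pos |].
  eapply Rle_trans; [apply exp_taylor1_bound |].
  rewrite Rabs_mult.
  set (a := Rabs (u t)). assert (Ha : 0 <= a) by apply Rabs_pos.
  rewrite Rpow_mult_distr, <- (pow2_abs (u t)). fold a.
  assert (H1 : exp (Rabs h * a) <= exp (d * a)) by (apply exp_le; nra).
  assert (H2 : (d * a) ^ 2 <= 4 * exp (d * a)) by (apply sqr_le_exp; nra).
  assert (H3 : a ^ 2 <= 4 / d ^ 2 * exp (d * a)).
  { apply (Rmult_le_reg_l (d ^ 2)); [nra |].
    replace (d ^ 2 * (4 / d ^ 2 * exp (d * a))) with (4 * exp (d * a)) by (field; lra).
    nra. }
  replace (exp (2 * (d * a))) with (exp (d * a) * exp (d * a))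
    by (rewrite <- exp_plus; f_equal; ring).
  match goal with |- _ <= ?r =>
    replace r with (h ^ 2 * (4 / d ^ 2 * exp (d * a) * exp (d * a))) by (field; lra) end.
  rewrite Rmult_assoc. apply Rmult_le_compat_l; [apply pow2_ge_0 |].
  apply Rmult_le_compat; try apply pow2_ge_0; try lra.
  apply Rlt_le, exp_pos.
Qed.

(** * The digamma function *)

Lemma ln_le_sub1 (v : R) : 0 < v -> ln v <= v - 1.
Proof.
  intros Hv. pose proof (exp_ineq1_le (ln v)) as H. rewrite exp_ln in H; lra.
Qed.

(** This bound is affine in [1/t] and the next one in [t], so against the Gamma integrand they
    integrate to Gamma at neighbouring arguments. *)
Lemma ln_ge_tangent (t c : R) : 0 < t -> 0 < c -> ln c + 1 - c / t <= ln t.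
Proof.
  intros Ht Hc.
  assert (H : ln (c / t) <= c / t - 1) by (apply ln_le_sub1, Rdiv_lt_0_compat; auto).
  rewrite ln_div in H; lra.
Qed.

Lemma ln_le_tangent (t c : R) : 0 < t -> 0 < c -> ln t <= ln c + t / c - 1.
Proof.
  intros Ht Hc.
  assert (H : ln (t / c) <= t / c - 1) by (apply ln_le_sub1, Rdiv_lt_0_compat; auto).
  rewrite ln_div in H; lra.
Qed.

Lemma admissible_Gamma : admissible ln 0 (fun t => exp (- t)).
Proof.
  assert (Hln : forall t, 0 < t -> continuous ln t).
  { intros t Ht. apply (ex_derive_continuous ln). auto_derive; auto. }
  assert (He : forall t, 0 < t -> continuous (fun t => exp (- t)) t).
  { intros t Ht. apply (ex_derive_continuous (fun t => exp (- t))). auto_derive; auto. }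
  split; [|split]; auto.
  intros s Hs. split.
  { intros t Ht. apply continuous_exp_mul; auto. }
  (* The tangent of [ln] at [2 s] gives [s ln t <= s (ln (2 s) - 1) + t / 2], which spends half of
     [e^(-t)]. *)
  exists (exp (s * (ln (2 * s) - 1))), (/ 2). split; [lra|].
  intros t Ht. rewrite <- !exp_plus, Rabs_right by (apply Rle_ge, Rlt_le, exp_pos).
  apply exp_le.
  pose proof (ln_le_tangent t (2 * s) Ht ltac:(lra)) as H.
  apply (Rmult_le_compat_l s) in H; [|lra].
  replace (s * (ln (2 * s) + t / (2 * s) - 1)) with (s * (ln (2 * s) - 1) + t / 2) in H
    by (field; lra).
  lra.
Qed.

Lemma exp_succ_ln (s t : R) : 0 < t -> exp ((s + 1) * ln t) = t * exp (s * ln t).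
Proof.
  intros Ht. replace ((s + 1) * ln t) with (ln t + s * ln t) by ring.
  rewrite exp_plus, exp_ln; auto.
Qed.

Lemma is_pint_Gamma (x : R) :
  1 < x -> is_pint (fun t => exp ((x - 1) * ln t) * exp (- t)) (Gamma x).
Proof.
  intros Hx. apply (ex_pint (fun t => exp ((x - 1) * ln t) * exp (- t))).
  apply admissible_Gamma. lra.
Qed.

Definition Gamma1 (x : R) : R :=
  pint (fun t => exp ((x - 1) * ln t) * (ln t * exp (- t))).

Lemma is_pint_Gamma1 (x : R) :
  1 < x -> is_pint (fun t => exp ((x - 1) * ln t) * (ln t * exp (- t))) (Gamma1 x).
Proof.
  intros Hx. apply ex_pint.
  apply (admissible_mul _ _ _ admissible_Gamma). lra.
Qed.

Lemma is_derive_Gamma (x : R) : 1 < x -> is_derive Gamma x (Gamma1 x).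
Proof.
  intros Hx.
  pose proof (is_derive_pint ln (fun t => exp (- t)) 0 (x - 1) admissible_Gamma
                ltac:(lra)) as H.
  replace (Gamma1 x) with (1 * Gamma1 x) by ring.
  apply (is_derive_comp (fun s => pint (fun t => exp (s * ln t) * exp (- t)))
           (fun x => x - 1) x).
  - exact H.
  - auto_derive; auto.
Qed.

Lemma Gamma_succ (x : R) : 1 < x -> Gamma (x + 1) = x * Gamma x.
Proof.
  intros Hx.
  (* Integration by parts: [- t^x e^(-t)] vanishes at both ends. *)
  set (f := fun t => - exp (x * ln t) * exp (- t)).
  assert (H : is_pint (fun t => exp (x * ln t) * exp (- t)
                           - x * (exp ((x - 1) * ln t) * exp (- t))) (0 - 0)).
  { apply (is_pint_Derive f).
    - intros t Ht. unfold f. auto_derive; auto.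
      replace (x * ln t) with ((x - 1 + 1) * ln t) by ring.
      rewrite exp_succ_ln by auto. field; lra.
    - intros t Ht. apply (ex_derive_continuous (fun t => exp (x * ln t) * exp (- t)
                           - x * (exp ((x - 1) * ln t) * exp (- t)))).
      auto_derive; auto.
    (* Since [x > 1], [t^x <= t] for [t < 1]. *)
    - apply filterlim_locally. intros eps.
      exists (mkposreal (Rmin 1 eps) (Rmin_pos _ _ Rlt_0_1 (cond_pos eps))).
      intros t Ht Ht0.
      unfold ball in *; simpl in *; unfold AbsRing_ball, abs, minus, plus, opp in *;
        simpl in *.
      rewrite Ropp_0, Rplus_0_r in *. rewrite Rabs_right in Ht by lra.
      pose proof (Rmin_l 1 eps). pose proof (Rmin_r 1 eps).
      unfold f. rewrite <- Ropp_mult_distr_l, Rabs_Ropp, <- exp_plus, Rabs_right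
        by (apply Rle_ge, Rlt_le, exp_pos).
      eapply Rle_lt_trans; [apply (exp_le _ (ln t))|].
      + assert (ln t < 0) by (rewrite <- ln_1; apply ln_increasing; lra). nra.
      + rewrite exp_ln; lra.
    - destruct admissible_Gamma as (_ & _ & Ha).
      destruct (Ha x ltac:(lra)) as [_ (C & c & Hc & Hb)].
      apply (filterlim_le_exp _ C c Hc). intros t Ht. unfold f.
      rewrite <- Ropp_mult_distr_l, Rabs_Ropp. auto. }
  assert (H2 : is_pint (fun t => exp (x * ln t) * exp (- t)
                           - x * (exp ((x - 1) * ln t) * exp (- t)))
                 (Gamma (x + 1) - x * Gamma x)).
  { apply is_pint_minus.
    - pose proof (is_pint_Gamma (x + 1) ltac:(lra)) as HG.
      replace (x + 1 - 1) with x in HG by ring. exact HG.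
    - apply is_pint_scal, is_pint_Gamma, Hx. }
  apply pint_unique in H, H2. lra.
Qed.

(* Bernoulli's inequality [t^s >= 1 + s (t - 1)] integrated against [exp (-t)]. *)
Lemma Gamma_ge1 (x : R) : 2 <= x -> 1 <= Gamma x.
Proof.
  intros Hx.
  set (s := x - 1).
  set (f := fun t => - (s * t + 1) * exp (- t)).
  assert (H : is_pint (fun t => (1 + s * (t - 1)) * exp (- t)) (0 - f 0)).
  { apply (is_pint_Derive f).
    - intros t Ht. unfold f. auto_derive; auto. ring.
    - intros t Ht. apply (ex_derive_continuous (fun t => (1 + s * (t - 1)) * exp (- t))).
      auto_derive; auto.
    - apply (continuous_at_right f). apply (ex_derive_continuous f). unfold f.
      auto_derive; auto.
    - apply (filterlim_le_exp _ (2 * s + 1) (/ 2)); [lra|].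
      intros t Ht. unfold f. rewrite <- Ropp_mult_distr_l, Rabs_Ropp.
      assert (Hs : 1 <= s) by (unfold s; lra).
      pose proof (exp_pos (- t)).
      rewrite Rabs_right by (apply Rle_ge, Rmult_le_pos; nra).
      pose proof (exp_ineq1_le (t / 2)).
      replace (exp (- (/ 2 * t))) with (exp (- t) * exp (t / 2))
        by (rewrite <- exp_plus; f_equal; field).
      rewrite (Rmult_comm (s * t + 1)), (Rmult_comm (2 * s + 1)), Rmult_assoc.
      apply Rmult_le_compat_l; [lra|].
      apply Rle_trans with ((1 + t / 2) * (2 * s + 1)); [nra|].
      apply Rmult_le_compat_r; lra. }
  replace (0 - f 0) with 1 in H
    by (unfold f; rewrite Rmult_0_r, Ropp_0, exp_0; ring).
  apply (is_pint_le _ _ _ _) with (2 := H) (3 := is_pint_Gamma x ltac:(lra)).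
  intros t Ht. apply Rmult_le_compat_r; [apply Rlt_le, exp_pos |]. fold s.
  (* [t^s = t t^(s-1) >= t (1 + (s-1) ln t)], and [t ln t >= t - 1]. *)
  replace s with (s - 1 + 1) at 2 by ring. rewrite exp_succ_ln by auto.
  pose proof (exp_ineq1_le ((s - 1) * ln t)).
  assert (Hl : 1 - / t <= ln t).
  { pose proof (ln_ge_tangent t 1 Ht Rlt_0_1) as H1. rewrite ln_1 in H1. lra. }
  apply (Rmult_le_compat_l t) in Hl; [|lra].
  rewrite Rmult_minus_distr_l, Rinv_r in Hl by lra.
  assert (1 <= s) by (unfold s; lra). nra.
Qed.

Lemma digamma_eq (x : R) : 1 < x -> digamma x = Gamma1 x / Gamma x.
Proof.
  intros Hx. unfold digamma. f_equal. now apply is_derive_unique, is_derive_Gamma.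
Qed.

(** The derivative of [Gamma (x + 1)] is computed directly and through the functional equation;
    [Gamma_ge1] permits the division. *)
Lemma digamma_succ (x : R) : 2 <= x -> digamma (x + 1) = digamma x + / x.
Proof.
  intros Hx. rewrite !digamma_eq by lra.
  pose proof (Gamma_ge1 x Hx).
  assert (H1 : is_derive (fun x => Gamma (x + 1)) x (1 * Gamma1 (x + 1))).
  { apply (is_derive_comp Gamma (fun x => x + 1)).
    - apply is_derive_Gamma; lra.
    - auto_derive; auto. }
  assert (H2 : is_derive (fun x => Gamma (x + 1)) x (1 * Gamma x + x * Gamma1 x)).
  { apply (is_derive_ext_loc (fun x => x * Gamma x)).
    - exists (mkposreal 1 Rlt_0_1). intros y Hy.
      apply ball_Rabs in Hy; simpl in Hy.
      apply Rabs_def2 in Hy. symmetry. apply Gamma_succ; lra.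
    - apply (is_derive_mult (fun x => x) Gamma).
      + apply (is_derive_id x).
      + apply is_derive_Gamma; lra.
      + intros; apply Rmult_comm. }
  apply is_derive_unique in H1, H2. rewrite H1 in H2.
  rewrite Gamma_succ by lra.
  replace (Gamma1 (x + 1)) with (Gamma x + x * Gamma1 x) by lra.
  field. lra.
Qed.

(** Jensen's inequality: the density [t^(x-1) e^(-t) / Gamma x] has mean [x], so the tangent of [ln]
    at [x] averages to [ln x]. *)
Lemma digamma_le_ln (x : R) : 2 <= x -> digamma x <= ln x.
Proof.
  intros Hx. rewrite digamma_eq by lra.
  pose proof (Gamma_ge1 x Hx) as Hg.
  apply (Rmult_le_reg_r (Gamma x)); [lra|].
  unfold Rdiv. rewrite Rmult_assoc, Rinv_l, Rmult_1_r by lra.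
  replace (ln x * Gamma x) with ((ln x - 1) * Gamma x + / x * Gamma (x + 1))
    by (rewrite Gamma_succ by lra; field; lra).
  eapply is_pint_le;
    [| apply is_pint_Gamma1; lra
     | apply is_pint_plus; apply is_pint_scal, is_pint_Gamma; lra].
  intros t Ht. simpl. replace (x + 1 - 1) with (x - 1 + 1) by ring.
  rewrite exp_succ_ln by auto.
  pose proof (ln_le_tangent t x Ht ltac:(lra)) as Hl.
  pose proof (exp_pos ((x - 1) * ln t)). pose proof (exp_pos (- t)).
  replace ((ln x - 1) * (exp ((x - 1) * ln t) * exp (- t)) +
    / x * (t * exp ((x - 1) * ln t) * exp (- t)))
    with (exp ((x - 1) * ln t) * ((ln x + t / x - 1) * exp (- t))) by (field; lra).
  apply Rmult_le_compat_l; [lra|]. apply Rmult_le_compat_r; lra.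
Qed.

(** Under the same density [1/t] has mean [1/(x-1)], so [c = x - 1] makes the lower bound average to
    [ln c]. *)
Lemma digamma_ge_ln (x : R) : 2 < x -> ln (x - 1) <= digamma x.
Proof.
  intros Hx. rewrite digamma_eq by lra.
  pose proof (Gamma_ge1 x ltac:(lra)) as Hg.
  apply (Rmult_le_reg_r (Gamma x)); [lra|].
  unfold Rdiv. rewrite Rmult_assoc, Rinv_l, Rmult_1_r by lra.
  pose proof (Gamma_succ (x - 1) ltac:(lra)) as HS.
  replace (x - 1 + 1) with x in HS by ring.
  replace (ln (x - 1) * Gamma x)
    with ((ln (x - 1) + 1) * Gamma x - (x - 1) * Gamma (x - 1)) by lra.
  eapply is_pint_le;
    [| apply is_pint_minus; apply is_pint_scal, is_pint_Gamma; lra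
     | apply is_pint_Gamma1; lra ].
  intros t Ht. simpl. replace (x - 1) with (x - 1 - 1 + 1) at 2 5 by ring.
  rewrite exp_succ_ln by auto.
  pose proof (ln_ge_tangent t (x - 1) Ht ltac:(lra)) as Hl.
  pose proof (exp_pos ((x - 1 - 1) * ln t)). pose proof (exp_pos (- t)).
  replace ((ln (x - 1) + 1) * (t * exp ((x - 1 - 1) * ln t) * exp (- t)) -
    (x - 1) * (exp ((x - 1 - 1) * ln t) * exp (- t)))
    with (t * exp ((x - 1 - 1) * ln t) * ((ln (x - 1) + 1 - (x - 1) / t) * exp (- t)))
    by (field; lra).
  apply Rmult_le_compat_l; [nra|]. apply Rmult_le_compat_r; lra.
Qed.

Lemma Rabs_le_all_eq0 (a C : R) : (forall n : nat, Rabs a * INR n <= C) -> a = 0.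
Proof.
  intros H. apply Classical_Prop.NNPP. intros Ha. apply Rabs_pos_lt in Ha.
  destruct (INR_archimed (Rabs a) C Ha) as [n Hn]. specialize (H n). nra.
Qed.

(** The difference of the two solutions has period 1 and is O(1/x), so following it along [x + n]
    shows that it vanishes. *)
Lemma digamma_characterization (f : R -> R) (C : R) :
  (forall x, 2 < x -> f (x + 1) = f x + / x) ->
  (forall x, 2 < x -> Rabs (f x - ln x) <= C / x) ->
  forall x, 2 < x -> digamma x = f x.
Proof.
  intros Hf Hb x Hx.
  assert (Hper : forall n : nat, digamma (x + INR n) - f (x + INR n) = digamma x - f x).
  { induction n as [|n IH].
    - simpl. now rewrite Rplus_0_r.
    - rewrite S_INR, <- Rplus_assoc. pose proof (pos_INR n).
      rewrite digamma_succ, Hf by lra. lra. }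
  assert (H : digamma x - f x = 0); [|lra].
  (* [C] bounds the error of [f]; the 2 comes from [ln v - ln (v - 1) <= 1/(v - 1) <= 2/v]. *)
  apply (Rabs_le_all_eq0 _ (C + 2)). intros n. rewrite <- (Hper n).
  pose proof (pos_INR n) as Hn. set (v := x + INR n). assert (Hv : 2 < v) by (unfold v; lra).
  assert (H1 : Rabs (digamma v - f v) <= (C + 2) / v).
  { pose proof (digamma_le_ln v ltac:(lra)). pose proof (digamma_ge_ln v Hv).
    pose proof (ln_ge_tangent (v - 1) v ltac:(lra) ltac:(lra)) as H2.
    pose proof (Hb v Hv) as H3. apply Rabs_le_between in H3.
    assert (v / (v - 1) - 1 <= 2 / v).
    { apply (Rmult_le_reg_r (v * (v - 1))); [nra|].
      replace ((v / (v - 1) - 1) * (v * (v - 1))) with v by (field; lra).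
      replace (2 / v * (v * (v - 1))) with (2 * (v - 1)) by (field; lra). lra. }
    replace ((C + 2) / v) with (C / v + 2 / v) by (field; lra).
    assert (0 < 2 / v) by (apply Rdiv_lt_0_compat; lra).
    apply Rabs_le. lra. }
  apply (Rmult_le_compat_r v) in H1; [|lra].
  unfold Rdiv in H1. rewrite (Rmult_assoc (C + 2)), Rinv_l, Rmult_1_r in H1 by lra.
  pose proof (Rabs_pos (digamma v - f v)).
  eapply Rle_trans; [|exact H1]. apply Rmult_le_compat_l; auto. unfold v; lra.
Qed.

(** * Smoothness of z / (exp z - 1) *)

(** n-fold differentiability on the whole line, with the derivative as an explicit witness so that
    closure under products and inverses is an induction on [n]. *)
Fixpoint Ck (n : nat) (f : R -> R) : Prop :=
  match n with
  | O => True
  | S m => exists g, (forall x, is_derive f x (g x)) /\ Ck m g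
  end.

Lemma Ck_pred (n : nat) (f : R -> R) : Ck (S n) f -> Ck n f.
Proof.
  revert f. induction n as [|n IH]; intros f [g [Hg HC]]; simpl; auto.
  exists g. split; auto.
Qed.

Lemma Ck_ext (n : nat) (f g : R -> R) : (forall x, f x = g x) -> Ck n f -> Ck n g.
Proof.
  destruct n; simpl; auto. intros H [h [Hh HC]]. exists h. split; auto.
  intros x. now apply (is_derive_ext f).
Qed.

Lemma Ck_opp (n : nat) (f : R -> R) : Ck n f -> Ck n (fun x => - f x).
Proof.
  revert f. induction n as [|n IH]; intros f; simpl; auto.
  intros [g [Hg HC]]. exists (fun x => - g x). split; auto.
  intros x. now apply (is_derive_opp f).
Qed.

Lemma Ck_plus (n : nat) (f g : R -> R) :
  Ck n f -> Ck n g -> Ck n (fun x => f x + g x).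
Proof.
  revert f g. induction n as [|n IH]; intros f g; simpl; auto.
  intros [f' [Hf HCf]] [g' [Hg HCg]]. exists (fun x => f' x + g' x). split; auto.
  intros x. now apply (is_derive_plus f g).
Qed.

Lemma Ck_mult (n : nat) (f g : R -> R) :
  Ck n f -> Ck n g -> Ck n (fun x => f x * g x).
Proof.
  revert f g. induction n as [|n IH]; intros f g; auto.
  intros Hf0 Hg0. pose proof (Ck_pred _ _ Hf0) as Hfn. pose proof (Ck_pred _ _ Hg0) as Hgn.
  destruct Hf0 as [f' [Hf HCf]]. destruct Hg0 as [g' [Hg HCg]].
  exists (fun x => f' x * g x + f x * g' x). split.
  - intros x. apply (is_derive_mult f g); auto. intros; apply Rmult_comm.
  - apply Ck_plus; auto.
Qed.

Lemma Ck_inv (n : nat) (f : R -> R) :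
  (forall x, f x <> 0) -> Ck n f -> Ck n (fun x => / f x).
Proof.
  intros H0. induction n as [|n IH]; auto.
  intros Hf0. pose proof (IH (Ck_pred _ _ Hf0)) as Hinv.
  destruct Hf0 as [f' [Hf HCf]].
  exists (fun x => - f' x * (/ f x * / f x)). split.
  - intros x. replace (- f' x * (/ f x * / f x)) with (- f' x / (f x) ^ 2)
      by (field; auto).
    apply is_derive_inv; auto.
  - apply Ck_mult; [now apply Ck_opp | now apply Ck_mult].
Qed.

Lemma Ck_const (n : nat) (c : R) : Ck n (fun _ => c).
Proof.
  revert c. induction n as [|n IH]; intros c; simpl; auto.
  exists (fun _ => 0). split; auto. intros x. apply (is_derive_const c).
Qed.

Lemma Ck_pow (n l : nat) (f : R -> R) : Ck n f -> Ck n (fun x => f x ^ l).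
Proof.
  intros Hf. induction l as [|l IH]; simpl; [apply Ck_const | now apply Ck_mult].
Qed.

Lemma Ck_PSeries (n : nat) (a : nat -> R) :
  CV_radius a = p_infty -> Ck n (PSeries a).
Proof.
  revert a. induction n as [|n IH]; intros a Ha; simpl; auto.
  exists (PSeries (PS_derive a)). split.
  - intros x. apply is_derive_PSeries. rewrite Ha. exact I.
  - apply IH. now rewrite CV_radius_derive.
Qed.

Lemma ex_derive_n_Ck (n : nat) (f : R -> R) (x : R) : Ck n f -> ex_derive_n f n x.
Proof.
  destruct n as [|n]; [easy|].
  revert f x. induction n as [|n IH]; intros f x [g [Hg HC]].
  - exists (g x). apply Hg.
  - assert (H : forall y, Derive f y = g y) by (intros y; now apply is_derive_unique).
    destruct (IH g x HC) as [l Hl]. exists l.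
    apply (is_derive_ext (Derive_n g n)); auto.
    (* [Derive_n] peels off the last derivative, [Ck] the first one; [Derive_n_comp] exchanges
       them. *)
    intros t. change (Derive_n f (S n) t) with (Derive_n f (1 + n) t).
    replace (1 + n)%nat with (n + 1)%nat by lia.
    rewrite <- Derive_n_comp. apply Derive_n_ext. intros y. symmetry. apply H.
Qed.

Lemma CV_radius_inv_fact : CV_radius (fun n => / INR (fact n)) = p_infty.
Proof.
  apply CV_radius_infinite_DAlembert.
  - intros n. apply Rinv_neq_0_compat, INR_fact_neq_0.
  - apply (is_lim_seq_ext (fun n => / INR (S n))).
    + intros n. change (fact (S n)) with (S n * fact n)%nat. rewrite mult_INR.
      pose proof (INR_fact_lt_0 n). pose proof (lt_0_INR (S n) ltac:(lia)).
      rewrite Rabs_right.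
      * field. lra.
      * replace (/ (INR (S n) * INR (fact n)) / / INR (fact n)) with (/ INR (S n))
          by (field; lra).
        apply Rle_ge, Rlt_le, Rinv_0_lt_compat; lra.
    + apply (is_lim_seq_incr_1 (fun n => / INR n)).
      apply (is_lim_seq_inv INR p_infty); [apply is_lim_seq_INR | easy].
Qed.

Lemma exp_sub1_neq0 (t : R) : t <> 0 -> exp t - 1 <> 0.
Proof.
  intros Ht H. apply Ht, exp_inv. rewrite exp_0. lra.
Qed.

Lemma bern_gen_eq (t : R) : t <> 0 -> bern_gen t = t / (exp t - 1).
Proof. intros Ht. unfold bern_gen. destruct (Req_EM_T t 0); easy. Qed.

(* [1 / bern_gen] is the everywhere convergent power series of [(exp z - 1) / z]. *)
Lemma bern_gen_inv_PSeries (t : R) :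
  bern_gen t = / PSeries (PS_decr_1 (fun n => / INR (fact n))) t.
Proof.
  pose proof (PSeries_decr_1 (fun n => / INR (fact n)) t
                (ex_intro _ _ (is_exp_Reals t))) as H.
  rewrite <- exp_Reals in H. simpl in H.
  unfold bern_gen. destruct (Req_EM_T t 0) as [->|Ht].
  - rewrite PSeries_0. unfold PS_decr_1. simpl. field.
  - pose proof (exp_sub1_neq0 t Ht) as He. rewrite Rinv_1 in H.
    replace (exp t - 1) with (t * PSeries (PS_decr_1 (fun n => / INR (fact n))) t) in *
      by lra.
    field. split; auto. intros H0. rewrite H0 in He. lra.
Qed.

Lemma Ck_bern_gen (n : nat) : Ck n bern_gen.
Proof.
  eapply Ck_ext; [intros x; symmetry; apply bern_gen_inv_PSeries |].
  apply Ck_inv.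
  (* At a zero of the series the convention [/ 0 = 0] would give [bern_gen x = 0], which its closed
     form excludes. *)
  - intros x H0. pose proof (bern_gen_inv_PSeries x) as H.
    rewrite H0, Rinv_0 in H. unfold bern_gen in H.
    destruct (Req_EM_T x 0) as [|Hx]; [lra|].
    pose proof (exp_sub1_neq0 x Hx) as He.
    apply Hx. apply (Rmult_eq_compat_r (exp x - 1)) in H.
    unfold Rdiv in H. rewrite Rmult_assoc, Rinv_l in H by auto. lra.
  - apply Ck_PSeries. rewrite CV_radius_decr_1. apply CV_radius_inv_fact.
Qed.

Lemma continuous_bern_gen_pow (l : nat) (t : R) : continuous (fun t => bern_gen t ^ l) t.
Proof.
  apply (ex_derive_continuous (fun t => bern_gen t ^ l)).
  destruct (Ck_pow 1 l _ (Ck_bern_gen 1)) as [g [Hg _]]. exists (g t). apply Hg.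
Qed.

Lemma bern_gen_pos (t : R) : 0 < t -> 0 < bern_gen t.
Proof.
  intros Ht. rewrite bern_gen_eq by lra.
  pose proof (exp_ineq1_le t). apply Rdiv_lt_0_compat; lra.
Qed.

Lemma bern_gen_le1 (t : R) : 0 < t -> bern_gen t <= 1.
Proof.
  intros Ht. rewrite bern_gen_eq by lra. pose proof (exp_ineq1_le t).
  apply Rle_div_l; lra.
Qed.

Lemma bern_gen_ge (t : R) : 0 < t -> 1 - t <= bern_gen t.
Proof.
  intros Ht. rewrite bern_gen_eq by lra. pose proof (exp_ineq1_le t).
  apply Rle_div_r; [lra|].
  pose proof (exp_ineq1_le (- t)) as H2. rewrite exp_Ropp in H2.
  pose proof (exp_pos t). apply (Rmult_le_compat_r (exp t)) in H2; [|lra].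
  rewrite Rinv_l in H2 by lra. nra.
Qed.

(** The linear lower bound keeps [(beta^l - 1) / t] bounded up to 0, which makes it Laplace
    transformable. *)
Lemma bern_gen_pow_bound (l : nat) (t : R) :
  0 < t -> 0 < bern_gen t ^ l <= 1 /\ 1 - INR l * t <= bern_gen t ^ l.
Proof.
  intros Ht. pose proof (bern_gen_pos t Ht). pose proof (bern_gen_le1 t Ht).
  pose proof (bern_gen_ge t Ht).
  induction l as [|l [IH1 IH2]]; [simpl; lra|].
  rewrite S_INR. pose proof (pos_INR l). simpl pow. split; nra.
Qed.

(** * Laplace transforms *)

(** Written with [y * - t] to be literally the case [u = Ropp] of the families above. *)
Definition laplace (phi : R -> R) (y : R) : R := pint (fun t => exp (y * - t) * phi t).

Definition laplaceable (phi : R -> R) : Prop := admissible Ropp 0 phi.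

Lemma is_pint_laplace (phi : R -> R) (y : R) :
  laplaceable phi -> 0 < y ->
  is_pint (fun t => exp (y * - t) * phi t) (laplace phi y).
Proof. intros (_ & _ & H) Hy. apply ex_pint. auto. Qed.

Lemma laplaceable_bounded (phi : R -> R) (C : R) :
  (forall t, 0 < t -> continuous phi t) ->
  (forall t, 0 < t -> Rabs (phi t) <= C) -> laplaceable phi.
Proof.
  intros Hc Hb.
  assert (Ho : forall t, 0 < t -> continuous Ropp t).
  { intros t _. apply (ex_derive_continuous Ropp). auto_derive; auto. }
  split; [|split]; auto. intros y Hy. split.
  - intros t Ht. apply (continuous_exp_mul Ropp); auto.
  - exists C, y. split; auto. intros t Ht.
    rewrite Rabs_mult, (Rabs_right (exp _)) by (apply Rle_ge, Rlt_le, exp_pos).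
    replace (y * - t) with (- (y * t)) by ring. rewrite Rmult_comm.
    apply Rmult_le_compat_r; [apply Rlt_le, exp_pos | auto].
Qed.

Lemma is_derive_laplace (phi : R -> R) (y : R) :
  laplaceable phi -> 0 < y ->
  is_derive (laplace phi) y (laplace (fun t => - t * phi t) y).
Proof. intros H Hy. exact (is_derive_pint Ropp phi 0 y H Hy). Qed.

Lemma laplaceable_mul (phi : R -> R) :
  laplaceable phi -> laplaceable (fun t => - t * phi t).
Proof. intros H. exact (admissible_mul Ropp phi 0 H). Qed.

Lemma laplace_unique (phi psi : R -> R) (y l : R) :
  (forall t, 0 < t -> exp (y * - t) * phi t = psi t) -> is_pint psi l ->
  laplace phi y = l.
Proof.
  intros H Hp. apply pint_unique. apply (is_pint_ext psi); auto.
  intros; symmetry; auto.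
Qed.

Lemma laplace_one (y : R) : 0 < y -> laplace (fun _ => 1) y = / y.
Proof.
  intros Hy. eapply laplace_unique; [|now apply is_pint_exp].
  intros t Ht. rewrite Rmult_1_r. f_equal. ring.
Qed.

Lemma laplace_abs_le (phi : R -> R) (C y : R) :
  laplaceable phi -> (forall t, 0 < t -> Rabs (phi t) <= C) -> 0 < y ->
  Rabs (laplace phi y) <= C / y.
Proof.
  intros Hl Hb Hy.
  apply (is_pint_abs_le _ (fun t => C * exp (- (y * t))) _ _)
    with (2 := is_pint_laplace phi y Hl Hy).
  - intros t Ht.
    rewrite Rabs_mult, (Rabs_right (exp _)) by (apply Rle_ge, Rlt_le, exp_pos).
    replace (y * - t) with (- (y * t)) by ring. rewrite Rmult_comm.
    apply Rmult_le_compat_r; [apply Rlt_le, exp_pos | auto].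
  - apply is_pint_scal. now apply is_pint_exp.
Qed.

Lemma continuous_one_sub_exp_div (t : R) :
  0 < t -> continuous (fun t => (1 - exp (- t)) / t) t.
Proof.
  intros Ht. apply (ex_derive_continuous (fun t => (1 - exp (- t)) / t)).
  auto_derive. lra.
Qed.

Lemma one_sub_exp_div_bound (t : R) : 0 < t -> Rabs ((1 - exp (- t)) / t) <= 1.
Proof.
  intros Ht. pose proof (exp_ineq1_le (- t)).
  assert (exp (- t) <= 1) by (rewrite <- exp_0; apply exp_le; lra).
  rewrite Rabs_right by (apply Rle_ge, Rdiv_le_0_compat; lra).
  apply Rle_div_l; lra.
Qed.

Lemma laplaceable_one_sub_exp_div : laplaceable (fun t => (1 - exp (- t)) / t).
Proof.
  exact (laplaceable_bounded _ 1 continuous_one_sub_exp_div one_sub_exp_div_bound).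
Qed.

Lemma eq0_of_le_div (a C y0 : R) :
  (forall y, y0 < y -> Rabs a <= C / y) -> a = 0.
Proof.
  intros H. apply Classical_Prop.NNPP. intros Ha. apply Rabs_pos_lt in Ha.
  set (y := Rmax (y0 + 1) (Rmax 1 (C / Rabs a + 1))).
  assert (H1 : y0 + 1 <= y) by apply Rmax_l.
  assert (H2 : Rmax 1 (C / Rabs a + 1) <= y) by apply Rmax_r.
  pose proof (Rmax_l 1 (C / Rabs a + 1)). pose proof (Rmax_r 1 (C / Rabs a + 1)).
  specialize (H y ltac:(lra)).
  assert (H5 : C / Rabs a + 1 <= y) by lra.
  apply (Rmult_le_compat_r y) in H; [|lra].
  unfold Rdiv in H. rewrite Rmult_assoc, Rinv_l, Rmult_1_r in H by lra.
  apply (Rmult_le_compat_r (Rabs a)) in H5; [|lra].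
  rewrite Rmult_plus_distr_r in H5.
  unfold Rdiv in H5. rewrite Rmult_assoc, Rinv_l in H5 by lra. lra.
Qed.

(* Both sides vanish at infinity and have the same derivative. *)
Lemma laplace_frullani (y : R) :
  0 < y -> laplace (fun t => (1 - exp (- t)) / t) y = ln (y + 1) - ln y.
Proof.
  intros Hy.
  set (F := fun y => laplace (fun t => (1 - exp (- t)) / t) y - (ln (y + 1) - ln y)).
  assert (HF : forall y, 0 < y -> is_derive F y 0).
  { intros x Hx. unfold F.
    (* Differentiation multiplies the kernel by [-t], cancelling the denominator and leaving
       [e^(-t) - 1]. *)
    replace 0 with (laplace (fun t => - t * ((1 - exp (- t)) / t)) x - (/ (x + 1) - / x)).
    - apply (is_derive_minus (laplace (fun t => (1 - exp (- t)) / t))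
               (fun y => ln (y + 1) - ln y)).
      + apply is_derive_laplace; auto. apply laplaceable_one_sub_exp_div.
      + auto_derive; [lra|]. field; lra.
    - rewrite (laplace_unique _ (fun t => exp (- ((x + 1) * t)) - exp (- (x * t))) x
                 (/ (x + 1) - / x)).
      + ring.
      + intros t Ht. replace (- ((x + 1) * t)) with (x * - t + - t) by ring.
        rewrite exp_plus. replace (- (x * t)) with (x * - t) by ring. field; lra.
      + apply is_pint_minus; apply is_pint_exp; lra. }
  assert (H : F y = 0); [|unfold F in H; lra].
  apply (eq0_of_le_div _ 2 y). intros x Hx.
  replace (F y) with (F x).
  2: { symmetry. apply (eq_is_derive F); auto. intros t Ht. apply HF. lra. }
  unfold F.
  pose proof (laplace_abs_le _ 1 x laplaceable_one_sub_exp_div one_sub_exp_div_bound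
                ltac:(lra)) as H1.
  pose proof (ln_le_tangent (x + 1) x ltac:(lra) ltac:(lra)) as H2.
  assert (ln x <= ln (x + 1)) by (apply ln_le; lra).
  replace ((x + 1) / x) with (1 + 1 / x) in H2 by (field; lra).
  apply Rabs_le_between in H1. apply Rabs_le.
  replace (2 / x) with (1 / x + 1 / x) by (field; lra). lra.
Qed.

(** * The Laplace transform of (beta^l - 1)/t *)

Definition bern_quot (l : nat) (t : R) : R := (bern_gen t ^ l - 1) / t.

Lemma bern_quot_bound (l : nat) (t : R) : 0 < t -> Rabs (bern_quot l t) <= INR l.
Proof.
  intros Ht. destruct (bern_gen_pow_bound l t Ht) as [[H1 H2] H3]. unfold bern_quot.
  replace ((bern_gen t ^ l - 1) / t) with (- ((1 - bern_gen t ^ l) / t)) by (field; lra).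
  rewrite Rabs_Ropp, Rabs_right by (apply Rle_ge, Rdiv_le_0_compat; lra).
  apply Rle_div_l; lra.
Qed.

Lemma laplaceable_bern_quot (l : nat) : laplaceable (bern_quot l).
Proof.
  apply (laplaceable_bounded _ (INR l)); [|apply bern_quot_bound].
  intros t Ht. unfold bern_quot.
  apply (continuous_mult (fun t => bern_gen t ^ l - 1) (fun t => / t)).
  - apply (continuous_minus (fun t => bern_gen t ^ l) (fun _ => 1)).
    + apply continuous_bern_gen_pow.
    + apply continuous_const.
  - apply (ex_derive_continuous Rinv). auto_derive; lra.
Qed.

Lemma laplaceable_bern_pow (l : nat) : laplaceable (fun t => bern_gen t ^ l).
Proof.
  apply (laplaceable_bounded _ 1).
  - intros; apply continuous_bern_gen_pow.
  - intros t Ht. destruct (bern_gen_pow_bound l t Ht). rewrite Rabs_right; lra.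
Qed.

(** The closed form for the derivative of order [l - 1]; at [l = 1] it is Binet's expression for
    [psi (y + 1)]. *)
Definition psi_laplace (l : nat) (y : R) : R :=
  ln y + harmonic (l - 1) - laplace (bern_quot l) y.

(** The derivative [1/y] of [ln] is the transform of 1 and cancels the one of the [-1] in
    [bern_quot]. *)
Lemma is_derive_psi_laplace (l : nat) (y : R) :
  0 < y -> is_derive (psi_laplace l) y (laplace (fun t => bern_gen t ^ l) y).
Proof.
  intros Hy. unfold psi_laplace.
  replace (laplace (fun t => bern_gen t ^ l) y)
    with (/ y - laplace (fun t => - t * bern_quot l t) y).
  - apply (is_derive_minus (fun y => ln y + harmonic (l - 1)) (laplace (bern_quot l))).
    + auto_derive; lra.
    + apply is_derive_laplace; auto. apply laplaceable_bern_quot.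
  - symmetry. eapply laplace_unique;
      [| apply is_pint_minus; [apply (is_pint_exp y Hy) |
         apply is_pint_laplace; [apply laplaceable_mul, laplaceable_bern_quot | auto]]].
    intros t Ht. simpl. unfold bern_quot. replace (- (y * t)) with (y * - t) by ring.
    field; lra.
Qed.

(* Integration by parts, using
   [(beta^l)' = l ((beta^l - 1) / t - beta^l - (beta^(l+1) - 1) / t)] for [beta = t / (e^t - 1)]. *)
Lemma laplace_bern_pow_parts (l : nat) (y : R) :
  0 < y ->
  y * laplace (fun t => bern_gen t ^ l) y
  = 1 + INR l * (laplace (bern_quot l) y - laplace (fun t => bern_gen t ^ l) y
                 - laplace (bern_quot (S l)) y).
Proof.
  intros Hy.
  set (D := fun t => INR l * (bern_quot l t - bern_gen t ^ l - bern_quot (S l) t)).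
  assert (HD : forall t, 0 < t -> is_derive (fun t => bern_gen t ^ l) t (D t)).
  { intros t Ht. pose proof (exp_ineq1_le t).
    apply (is_derive_ext_loc (fun t => (t / (exp t - 1)) ^ l)).
    - exists (mkposreal t Ht). intros u Hu.
      apply ball_Rabs in Hu; simpl in Hu.
      apply Rabs_def2 in Hu. rewrite bern_gen_eq by lra. reflexivity.
    - unfold D, bern_quot. rewrite bern_gen_eq by lra.
      auto_derive; [lra|].
      destruct l as [|l]; [simpl; ring|].
      change (pred (S l)) with l. simpl pow.
      change (t * / (exp t + - (1))) with (t / (exp t - 1)).
      generalize ((t / (exp t - 1)) ^ l). intros P. field. lra. }
  set (f := fun t => exp (y * - t) * bern_gen t ^ l).
  (* The derivative of [f], expanded into Laplace integrands so that it can also be integrated term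
     by term. *)
  set (df := fun t => - y * (exp (y * - t) * bern_gen t ^ l)
     + INR l * (exp (y * - t) * bern_quot l t - exp (y * - t) * bern_gen t ^ l
                - exp (y * - t) * bern_quot (S l) t)).
  assert (He : forall t, is_derive (fun t => exp (y * - t)) t (- y * exp (y * - t))).
  { intros t. auto_derive; auto. ring. }
  pose proof (laplaceable_bern_quot l) as (_ & Hc1 & _).
  pose proof (laplaceable_bern_quot (S l)) as (_ & Hc2 & _).
  assert (Hce : forall t, continuous (fun t => exp (y * - t)) t).
  { intros t. apply (ex_derive_continuous (fun t => exp (y * - t))).
    eexists; apply He. }
  assert (Hcf : forall t, continuous f t).
  { intros t. apply (continuous_mult (fun t => exp (y * - t)) (fun t => bern_gen t ^ l)).
    - apply Hce.
    - apply continuous_bern_gen_pow. }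
  assert (H1 : is_pint df (0 - f 0)).
  { apply (is_pint_Derive f).
    - intros t Ht. unfold df.
      replace (- y * (exp (y * - t) * bern_gen t ^ l) + _)
        with (- y * exp (y * - t) * bern_gen t ^ l + exp (y * - t) * D t)
        by (unfold D; ring).
      apply (is_derive_mult (fun t => exp (y * - t)) (fun t => bern_gen t ^ l)); auto.
      intros; apply Rmult_comm.
    - intros t Ht. unfold df.
      apply (continuous_plus (fun t => - y * f t)
        (fun t => INR l * (exp (y * - t) * bern_quot l t - f t
                - exp (y * - t) * bern_quot (S l) t))).
      + apply (continuous_mult (fun _ => - y) f); auto. apply continuous_const.
      + apply (continuous_mult (fun _ => INR l)); [apply continuous_const|].
        apply (continuous_minus (fun t => exp (y * - t) * bern_quot l t - f t)
                 (fun t => exp (y * - t) * bern_quot (S l) t)).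
        * apply (continuous_minus (fun t => exp (y * - t) * bern_quot l t) f); auto.
          apply (continuous_mult (fun t => exp (y * - t)) (bern_quot l)); auto.
        * apply (continuous_mult (fun t => exp (y * - t)) (bern_quot (S l))); auto.
    - now apply (continuous_at_right f).
    - apply (filterlim_le_exp _ 1 y Hy). intros t Ht. unfold f.
      destruct (bern_gen_pow_bound l t Ht) as [[Hb1 Hb2] _].
      rewrite Rabs_mult, !Rabs_right by (try apply Rle_ge; try apply Rlt_le; auto;
        apply exp_pos).
      rewrite Rmult_comm. replace (- (y * t)) with (y * - t) by ring.
      apply Rmult_le_compat_r; auto. apply Rlt_le, exp_pos. }
  (* The boundary term at 0 relies on the removable value [bern_gen 0 = 1]. *)
  assert (Hf0 : f 0 = 1).
  { unfold f. unfold bern_gen. destruct (Req_EM_T 0 0); [|easy].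
    rewrite Ropp_0, Rmult_0_r, exp_0, pow1. ring. }
  rewrite Hf0 in H1.
  assert (H2 : is_pint df (- y * laplace (fun t => bern_gen t ^ l) y
     + INR l * (laplace (bern_quot l) y - laplace (fun t => bern_gen t ^ l) y
                 - laplace (bern_quot (S l)) y))).
  { pose proof (is_pint_laplace _ y (laplaceable_bern_pow l) Hy) as I0.
    pose proof (is_pint_laplace _ y (laplaceable_bern_quot l) Hy) as I1.
    pose proof (is_pint_laplace _ y (laplaceable_bern_quot (S l)) Hy) as I2.
    exact (is_pint_plus _ _ _ _ (is_pint_scal _ _ _ I0)
      (is_pint_scal _ _ _ (is_pint_minus _ _ _ _ (is_pint_minus _ _ _ _ I1 I0) I2))). }
  apply pint_unique in H1, H2. lra.
Qed.

Lemma harmonic_pred (l : nat) : (1 <= l)%nat -> harmonic l = harmonic (l - 1) + / INR l.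
Proof. destruct l; [lia|]. intros _. simpl. now rewrite Nat.sub_0_r. Qed.

(** The parts formula divided by [l]: its boundary term [1/l] advances the harmonic number. *)
Lemma psi_laplace_succ (l : nat) (y : R) :
  (1 <= l)%nat -> 0 < y ->
  psi_laplace (S l) y
  = psi_laplace l y + (y + INR l) / INR l * laplace (fun t => bern_gen t ^ l) y.
Proof.
  intros Hl Hy. pose proof (laplace_bern_pow_parts l y Hy) as H.
  assert (Hn : 0 < INR l) by (apply lt_0_INR; lia).
  unfold psi_laplace. replace (S l - 1)%nat with l by lia.
  rewrite (harmonic_pred l Hl).
  set (A := laplace (fun t => bern_gen t ^ l) y) in *.
  replace ((y + INR l) / INR l * A) with ((y * A) / INR l + A) by (field; lra).
  rewrite H. field. lra.
Qed.

(* Since [beta (1 - e^-t) / t = e^-t], the difference is a Frullani integral plus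
   the transform of [e^-t beta^l]. *)
Lemma psi_laplace_shift (l : nat) (y : R) :
  0 < y ->
  psi_laplace (S l) (y + 1) - psi_laplace (S l) y
  = laplace (fun t => bern_gen t ^ l) (y + 1).
Proof.
  intros Hy. unfold psi_laplace.
  pose proof (laplace_frullani y Hy) as HF.
  assert (H : laplace (bern_quot (S l)) (y + 1)
     = laplace (bern_quot (S l)) y - laplace (fun t => bern_gen t ^ l) (y + 1)
       + laplace (fun t => (1 - exp (- t)) / t) y).
  { eapply laplace_unique; [|apply is_pint_plus; [apply is_pint_minus|];
      apply is_pint_laplace; try lra;
      [apply laplaceable_bern_quot | apply laplaceable_bern_pow
       | apply laplaceable_one_sub_exp_div]].
    intros t Ht. simpl.
    replace ((y + 1) * - t) with (y * - t + - t) by ring. rewrite exp_plus.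
    assert (Hb : bern_gen t * (1 - exp (- t)) = t * exp (- t)).
    { rewrite bern_gen_eq, exp_Ropp by lra. pose proof (exp_ineq1_le t).
      pose proof (exp_pos t). field. lra. }
    unfold bern_quot. simpl pow.
    set (P := bern_gen t ^ l). set (E := exp (- t)) in *.
    (* Applied to one factor of [beta^(l+1)], this rewrites the kernel at [y] in terms of the kernel
       at [y + 1]. *)
    assert (Hb2 : bern_gen t = t * E + bern_gen t * E) by lra.
    apply (Rmult_eq_reg_r t); [|lra]. field_simplify; try lra.
    rewrite Hb2 at 2. ring. }
  lra.
Qed.

Lemma digamma_eq_psi_laplace (v : R) : 2 < v -> digamma v = psi_laplace 1 (v - 1).
Proof.
  apply (digamma_characterization (fun v => psi_laplace 1 (v - 1)) 4).
  (* At [l = 0] the increment is the transform of 1, which is the [1/x] of the difference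
     equation. *)
  - intros x Hx. pose proof (psi_laplace_shift 0 (x - 1) ltac:(lra)) as H.
    simpl pow in H. rewrite laplace_one in H by lra.
    replace (x - 1 + 1) with x in H by ring. replace (x + 1 - 1) with x by ring. lra.
  - intros x Hx. unfold psi_laplace. simpl harmonic.
    pose proof (laplace_abs_le (bern_quot 1) (INR 1) (x - 1) (laplaceable_bern_quot 1)
                  (bern_quot_bound 1) ltac:(lra)) as H1.
    simpl INR in H1.
    assert (Hle : 1 / (x - 1) <= 2 / x).
    { apply Rle_div_l; [lra|]. apply (Rmult_le_reg_r x); [lra|].
      replace (2 / x * (x - 1) * x) with (2 * (x - 1)) by (field; lra). lra. }
    assert (ln (x - 1) <= ln x) by (apply ln_le; lra).
    pose proof (ln_ge_tangent (x - 1) x ltac:(lra) ltac:(lra)) as H2.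
    replace (x / (x - 1)) with (1 + 1 / (x - 1)) in H2 by (field; lra).
    replace (4 / x) with (2 / x + 2 / x) by (field; lra).
    apply Rabs_le_between in H1. apply Rabs_le. lra.
Qed.

(** * The higher derivative of the binomial-digamma product *)

Lemma locally_gt (X x : R) : X < x -> locally x (fun y => X < y).
Proof.
  intros H. assert (Hd : 0 < x - X) by lra.
  exists (mkposreal _ Hd). intros y Hy.
  apply ball_Rabs in Hy; simpl in Hy.
  apply Rabs_def2 in Hy. lra.
Qed.

(** Explicit derivatives of every order on a half-line only, since [digamma] is controlled only for
    large arguments. *)
Definition derivative_chain (X : R) (f : R -> R) (F : nat -> R -> R) : Prop :=
  (forall x, X < x -> f x = F O x) /\
  forall n x, X < x -> is_derive (F n) x (F (S n) x).

Lemma derivative_chain_Derive_n (X : R) (f : R -> R) (F : nat -> R -> R) (n : nat) (x : R) :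
  derivative_chain X f F -> X < x -> Derive_n f n x = F n x.
Proof.
  intros [H0 H]. revert x. induction n as [|n IH]; intros x Hx; simpl; auto.
  rewrite (Derive_ext_loc _ (F n)).
  - now apply is_derive_unique, H.
  - eapply filter_imp; [|apply (locally_gt X x Hx)]. auto.
Qed.

(** The Leibniz rule stops after two terms for a linear factor; at order 0 the value at [pred 0] is
    multiplied by [INR 0]. *)
Lemma derivative_chain_mul_linear (X c k : R) (f : R -> R) (F : nat -> R -> R) :
  derivative_chain X f F ->
  derivative_chain X (fun x => k * ((x + c) * f x))
    (fun n x => k * ((x + c) * F n x + INR n * F (pred n) x)).
Proof.
  intros [H0 H]. split.
  - intros x Hx. simpl. rewrite H0 by auto. ring.
  - intros n x Hx.
    apply (is_derive_scal (fun x => (x + c) * F n x + INR n * F (pred n) x)).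
    replace ((x + c) * F (S n) x + INR (S n) * F (pred (S n)) x)
      with ((1 * F n x + (x + c) * F (S n) x) + INR n * F n x)
      by (rewrite S_INR; simpl; ring).
    apply (is_derive_plus (fun x => (x + c) * F n x) (fun x => INR n * F (pred n) x)).
    + apply (is_derive_mult (fun x => x + c) (F n)); auto.
      * auto_derive; auto.
      * intros; apply Rmult_comm.
    + destruct n as [|n].
      * simpl. rewrite Rmult_0_l. apply (is_derive_ext (fun _ => 0)).
        -- intros t; symmetry; apply Rmult_0_l.
        -- apply (is_derive_const 0).
      * apply (is_derive_scal (F n)). now apply H.
Qed.

Lemma derivative_chain_ext (X Y : R) (f g : R -> R) (F : nat -> R -> R) :
  X <= Y -> (forall x, Y < x -> g x = f x) ->
  derivative_chain X f F -> derivative_chain Y g F.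
Proof.
  intros HXY Hfg [H0 H]. split.
  - intros x Hx. rewrite Hfg by auto. apply H0. lra.
  - intros n x Hx. apply H. lra.
Qed.

Fixpoint laplace_kernel_deriv (phi : R -> R) (n : nat) : R -> R :=
  match n with
  | O => phi
  | S m => fun t => - t * laplace_kernel_deriv phi m t
  end.

Lemma laplaceable_kernel_deriv (phi : R -> R) (n : nat) :
  laplaceable phi -> laplaceable (laplace_kernel_deriv phi n).
Proof.
  intros H. induction n as [|n IH]; simpl; auto.
  exact (laplaceable_mul _ IH).
Qed.

Lemma is_derive_comp_add_r (f : R -> R) (c x l : R) :
  is_derive f (x + c) l -> is_derive (fun x => f (x + c)) x l.
Proof.
  intros H. replace l with (1 * l) by ring.
  apply (is_derive_comp f (fun x => x + c)); auto. auto_derive; auto.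
Qed.

Lemma digamma_derivative_chain :
  exists F, derivative_chain 2 digamma F /\
    forall v, 2 < v -> F O v = psi_laplace 1 (v - 1).
Proof.
  exists (fun n v => match n with
    | O => psi_laplace 1 (v + - 1)
    | S m => laplace (laplace_kernel_deriv (fun t => bern_gen t ^ 1) m) (v + - 1)
    end).
  split; [split|].
  - exact digamma_eq_psi_laplace.
  - intros [|n] x Hx; apply is_derive_comp_add_r.
    + apply is_derive_psi_laplace. lra.
    + apply is_derive_laplace; [|lra].
      apply laplaceable_kernel_deriv, laplaceable_bern_pow.
  - easy.
Qed.

Lemma gbinom_succ_r (x : R) (n : nat) :
  gbinom x (S n) = / INR (S n) * ((x - INR n) * gbinom x n).
Proof.
  unfold gbinom. simpl falling. change (fact (S n)) with (S n * fact n)%nat.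
  rewrite mult_INR. pose proof (INR_fact_neq_0 n). pose proof (not_0_INR (S n) ltac:(lia)).
  field. auto.
Qed.

Lemma falling_succ_l (x : R) (n : nat) : falling (x + 1) (S n) = (x + 1) * falling x n.
Proof.
  induction n as [|n IH]; [simpl; ring|].
  change (falling (x + 1) (S (S n))) with (falling (x + 1) (S n) * (x + 1 - INR (S n))).
  rewrite IH, S_INR. simpl. ring.
Qed.

Lemma gbinom_succ_l (x : R) (n : nat) :
  gbinom (x + 1) (S n) = / INR (S n) * ((x + 1) * gbinom x n).
Proof.
  unfold gbinom. rewrite falling_succ_l. change (fact (S n)) with (S n * fact n)%nat.
  rewrite mult_INR. pose proof (INR_fact_neq_0 n). pose proof (not_0_INR (S n) ltac:(lia)).
  field. auto.
Qed.

(** The function of the theorem after [v = x - b], with [l = a + b + 1]: its linear factors are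
    [v, ..., v + b - 1] and [v - 1, ..., v - a]. *)
Definition binom_digamma (a b : nat) (v : R) : R :=
  gbinom (v + INR b - 1) (a + b) * digamma v.

(** The chain of all orders is carried along because the Leibniz rule needs more than the derivative
    of order [a + b]. The threshold [a + 2] means [y = v - a - 1 > 1]. *)
Definition binom_digamma_spec (a b : nat) : Prop :=
  exists F, derivative_chain (INR a + 2) (binom_digamma a b) F /\
    forall v, INR a + 2 < v -> F (a + b)%nat v = psi_laplace (S (a + b)) (v - INR a - 1).

(** Adjoining a factor raises the order by one; this further derivative is read off by
    differentiating the closed form. *)
Lemma binom_digamma_chain_succ (a b : nat) (F : nat -> R -> R) (v : R) :
  derivative_chain (INR a + 2) (binom_digamma a b) F ->
  (forall v, INR a + 2 < v -> F (a + b)%nat v = psi_laplace (S (a + b)) (v - INR a - 1)) ->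
  INR a + 2 < v ->
  F (S (a + b)) v = laplace (fun t => bern_gen t ^ S (a + b)) (v - INR a - 1).
Proof.
  intros [_ HF] Hv Hlt.
  pose proof (is_derive_unique _ _ _ (HF (a + b)%nat v Hlt)) as H1. rewrite <- H1.
  apply is_derive_unique.
  apply (is_derive_ext_loc (fun v => psi_laplace (S (a + b)) (v + (- INR a - 1)))).
  - eapply filter_imp; [|apply (locally_gt _ v Hlt)].
    intros y Hy. rewrite Hv by auto. f_equal. ring.
  - apply is_derive_comp_add_r.
    replace (v + (- INR a - 1)) with (v - INR a - 1) by ring.
    apply is_derive_psi_laplace. lra.
Qed.

(* The new factor is [v + b = y + (a + b + 1)] with [y = v - a - 1]. *)
Lemma binom_digamma_spec_succ_r (a b : nat) :
  binom_digamma_spec a b -> binom_digamma_spec a (S b).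
Proof.
  intros (F & HF & Hv).
  pose proof (fun v => binom_digamma_chain_succ a b F v HF Hv) as Hv'.
  pose proof (derivative_chain_mul_linear _ (INR b) (/ INR (S (a + b))) _ _ HF) as HG.
  eexists. split.
  - eapply derivative_chain_ext; [apply Rle_refl | | exact HG].
    intros x Hx. unfold binom_digamma.
    replace (a + S b)%nat with (S (a + b)) by lia.
    replace (x + INR (S b) - 1) with (x + INR b - 1 + 1) by (rewrite S_INR; ring).
    rewrite gbinom_succ_l. ring.
  - intros v Hlt. cbv beta. replace (a + S b)%nat with (S (a + b)) by lia. simpl pred.
    rewrite Hv, Hv' by auto.
    rewrite (psi_laplace_succ (S (a + b))) by (lia || lra).
    pose proof (lt_0_INR (S (a + b)) ltac:(lia)).
    replace (v - INR a - 1 + INR (S (a + b))) with (v + INR b)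
      by (rewrite S_INR, plus_INR; ring).
    field. lra.
Qed.

(* The new factor is [v - 1 - a = y], and the value moves from [y] to [y - 1]. *)
Lemma binom_digamma_spec_succ_l (a b : nat) :
  binom_digamma_spec a b -> binom_digamma_spec (S a) b.
Proof.
  intros (F & HF & Hv).
  pose proof (fun v => binom_digamma_chain_succ a b F v HF Hv) as Hv'.
  pose proof (derivative_chain_mul_linear _ (- 1 - INR a) (/ INR (S (a + b))) _ _ HF) as HG.
  eexists. split.
  - eapply derivative_chain_ext; [ | | exact HG].
    + rewrite S_INR; lra.
    + intros x Hx. unfold binom_digamma.
      replace (S a + b)%nat with (S (a + b)) by lia.
      rewrite gbinom_succ_r, plus_INR. ring.
  - intros v Hlt. rewrite (S_INR a) in *. cbv beta.
    replace (S a + b)%nat with (S (a + b)) by lia. simpl pred.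
    rewrite Hv, Hv' by lra.
    (* Here Leibniz yields the factor [y / l] in place of [(y + l) / l], with [l = a + b + 1]; the
       missing transform of [beta^l] is exactly the cost of moving from [y] to [y - 1]. *)
    pose proof (psi_laplace_succ (S (a + b)) (v - INR a - 1) ltac:(lia) ltac:(lra)) as H1.
    pose proof (psi_laplace_shift (S (a + b)) (v - (INR a + 1) - 1) ltac:(lra)) as H2.
    replace (v - (INR a + 1) - 1 + 1) with (v - INR a - 1) in H2 by ring.
    pose proof (lt_0_INR (S (a + b)) ltac:(lia)).
    replace (psi_laplace (S (S (a + b))) (v - (INR a + 1) - 1))
      with (psi_laplace (S (S (a + b))) (v - INR a - 1)
            - laplace (fun t => bern_gen t ^ S (a + b)) (v - INR a - 1)) by lra.
    rewrite H1. field. lra.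
Qed.

Lemma binom_digamma_spec_all (a b : nat) : binom_digamma_spec a b.
Proof.
  induction b as [|b IH]; [|now apply binom_digamma_spec_succ_r].
  induction a as [|a IH]; [|now apply binom_digamma_spec_succ_l].
  destruct digamma_derivative_chain as (F & HF & Hv). exists F. split.
  - eapply derivative_chain_ext; [ | | exact HF].
    + simpl; lra.
    + intros x Hx. unfold binom_digamma, gbinom. simpl. field.
  - intros v Hlt. simpl in *. rewrite Hv by lra. f_equal. ring.
Qed.

(** The harmonic number of the right-hand side cancels the one in [psi_laplace]. *)
Lemma FBstar_rhs_laplace (l : nat) (z : R) :
  (1 <= l)%nat -> 0 < z -> 1 < z + / z - 2 ->
  FBstar_rhs l z = - / 2 * (ln z + ln (z + / z - 2))
                   + / 2 * laplace (bern_quot l) (z + / z - 2).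
Proof.
  intros Hl Hz Hy. unfold FBstar_rhs. set (y := z + / z - 2) in *.
  set (b := Nat.div l 2).
  (* Hence [floor(l/2)] is an admissible shift, leaving [a = l - 1 - b] factors below. *)
  assert (Hb : (b <= l - 1)%nat).
  { unfold b. pose proof (Nat.div_lt l 2 ltac:(lia) ltac:(lia)). lia. }
  set (a := (l - 1 - b)%nat).
  assert (Hab : (a + b)%nat = (l - 1)%nat) by (unfold a; lia).
  assert (HlR : INR l = INR a + INR b + 1).
  { rewrite <- plus_INR, Hab, minus_INR by lia. simpl. ring. }
  destruct (binom_digamma_spec_all a b) as (F & HF & Hv).
  rewrite (Derive_n_ext _ (fun x => binom_digamma a b (x + - INR b))).
  2: { intros x. unfold binom_digamma. rewrite Hab.
       replace (x + - INR b + INR b - 1) with (x - 1) by ring. reflexivity. }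
  rewrite Derive_n_comp_trans.
  replace (z + / z + INR l - 2 + - INR b) with (y + INR a + 1)
    by (unfold y; rewrite HlR; ring).
  rewrite (derivative_chain_Derive_n _ _ _ _ _ HF) by lra.
  rewrite <- Hab, Hv by lra. rewrite Hab.
  replace (S (l - 1)) with l by lia.
  replace (y + INR a + 1 - INR a - 1) with y by ring.
  unfold psi_laplace. ring.
Qed.

(** * Watson's lemma for the Laplace transform *)

Lemma norlund_0 (l : nat) : norlund l 0 = 1.
Proof.
  unfold norlund, bern_gen. simpl. destruct (Req_EM_T 0 0); [apply pow1 | easy].
Qed.

(** The bound must hold on the whole half-line to be integrated. Up to 1 it is the Lagrange
    remainder; beyond 1 both [beta^l] and the Taylor polynomial are at most a multiple of
    [t^(N+1)]. *)
Lemma norlund_taylor (l N : nat) :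
  exists C, forall t, 0 < t ->
    Rabs (bern_gen t ^ l - sum_f_R0 (fun m => norlund l m / INR (fact m) * t ^ m) N)
    <= C * t ^ S N.
Proof.
  set (f := fun t => bern_gen t ^ l).
  assert (Hf : forall n t, ex_derive_n f n t).
  { intros n t. apply ex_derive_n_Ck, Ck_pow, Ck_bern_gen. }
  destruct (continuity_ab_maj (fun t => Rabs (Derive_n f (S N) t)) 0 1) as [M [HM _]].
  { lra. }
  { intros c _. apply continuity_pt_filterlim.
    apply (continuous_comp (Derive_n f (S N)) Rabs); [|apply continuous_Rabs].
    apply (ex_derive_continuous (Derive_n f (S N))). exact (Hf (S (S N)) c). }
  set (C1 := Rabs (Derive_n f (S N) M)) in *.
  assert (HC1 : 0 <= C1) by apply Rabs_pos.
  set (C2 := sum_f_R0 (fun m => Rabs (norlund l m / INR (fact m))) N).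
  assert (HC2 : 0 <= C2) by (apply cond_pos_sum; intros; apply Rabs_pos).
  exists (C1 + (1 + C2)). intros t Ht.
  assert (Htp : 0 < t ^ S N) by now apply pow_lt.
  destruct (Rle_dec t 1) as [Ht1|Ht1].
  - destruct (Taylor_Lagrange f N 0 t Ht) as (zeta & Hz & Heq); [auto|].
    assert (Hs : sum_f_R0 (fun m => (t - 0) ^ m / INR (fact m) * Derive_n f m 0) N
      = sum_f_R0 (fun m => norlund l m / INR (fact m) * t ^ m) N).
    { apply sum_eq. intros i _. rewrite Rminus_0_r. unfold norlund.
      change (fun z => bern_gen z ^ l) with f. unfold Rdiv. ring. }
    rewrite Hs in Heq. change (bern_gen t ^ l) with (f t). rewrite Heq, Rminus_0_r.
    match goal with |- Rabs (?a + ?b - ?a) <= _ => replace (a + b - a) with b by ring end.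
    specialize (HM zeta ltac:(lra)).
    assert (Hfa : 1 <= INR (fact (S N))).
    { change 1 with (INR 1). apply le_INR. pose proof (lt_O_fact (S N)). lia. }
    rewrite Rabs_mult, (Rabs_right (t ^ S N / _))
      by (apply Rle_ge, Rdiv_le_0_compat; lra).
    assert (t ^ S N / INR (fact (S N)) <= t ^ S N) by (apply Rle_div_l; nra).
    assert (0 <= t ^ S N / INR (fact (S N))) by (apply Rdiv_le_0_compat; lra).
    pose proof (Rabs_pos (Derive_n f (S N) zeta)). nra.
  - destruct (bern_gen_pow_bound l t Ht) as [Hb _].
    assert (H1 : 1 <= t ^ S N) by (apply pow_R1_Rle; lra).
    assert (H2 : Rabs (sum_f_R0 (fun m => norlund l m / INR (fact m) * t ^ m) N)
       <= C2 * t ^ S N).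
    { eapply Rle_trans; [apply Rsum_abs|]. unfold C2.
      rewrite (Rmult_comm (sum_f_R0 _ _)), scal_sum. apply sum_Rle. intros n Hn.
      rewrite Rabs_mult, (Rabs_right (t ^ n)) by (apply Rle_ge, pow_le; lra).
      apply Rmult_le_compat_l; [apply Rabs_pos|]. apply Rle_pow; [lra|lia]. }
    apply Rabs_le_between in H2. apply Rabs_le. nra.
Qed.

(** Differentiates the transform [1/y] of 1 [n] times; the sign of the kernel [(-t)^n] is then
    removed. *)
Lemma is_pint_laplace_pow (n : nat) (y : R) :
  0 < y -> is_pint (fun t => exp (y * - t) * t ^ n) (INR (fact n) / y ^ S n).
Proof.
  assert (Hl : laplaceable (fun _ => 1)).
  { apply (laplaceable_bounded _ 1).
    - intros; apply continuous_const.
    - intros; rewrite Rabs_R1; lra. }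
  set (k := laplace_kernel_deriv (fun _ => 1)).
  assert (Hk : forall n t, k n t = (-1) ^ n * t ^ n).
  { intros m t. unfold k. induction m as [|m IH]; simpl; [ring|]. rewrite IH. ring. }
  assert (Hlk : forall n, laplaceable (k n)) by (intros; now apply laplaceable_kernel_deriv).
  assert (HL : forall n y, 0 < y -> laplace (k n) y = (-1) ^ n * (INR (fact n) / y ^ S n)).
  { clear n y. induction n as [|n IH]; intros y Hy.
    - unfold k; simpl laplace_kernel_deriv. rewrite laplace_one by auto. simpl. field. lra.
    - pose proof (is_derive_laplace (k n) y (Hlk n) Hy) as Hd.
      apply is_derive_unique in Hd.
      change (fun t => - t * k n t) with (k (S n)) in Hd. rewrite <- Hd.
      rewrite (Derive_ext_loc _ (fun y => (-1) ^ n * (INR (fact n) / y ^ S n))).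
      2: { eapply filter_imp; [|apply (locally_gt 0 y Hy)]. auto. }
      apply is_derive_unique.
      assert (y ^ n <> 0) by (apply pow_nonzero; lra).
      auto_derive.
      + apply Rmult_integral_contrapositive; split; auto; lra.
      + change (fact (S n)) with (S n * fact n)%nat. rewrite mult_INR.
        change (pred (S n)) with n.
        rewrite <- !tech_pow_Rmult.
        match goal with |- context [match n with O => 1 | S _ => INR n + 1 end] =>
          change (match n with O => 1 | S _ => INR n + 1 end) with (INR (S n)) end.
        field. split; auto; lra. }
  intros Hy.
  pose proof (is_pint_scal ((-1) ^ n) _ _ (is_pint_laplace (k n) y (Hlk n) Hy)) as H.
  rewrite HL in H by auto.
  assert (H1 : (-1) ^ n * (-1) ^ n = 1) by (rewrite <- Rpow_mult_distr, <- (pow1 n); f_equal; ring).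
  rewrite <- Rmult_assoc, H1, Rmult_1_l in H.
  eapply is_pint_ext; [|exact H]. intros t Ht. simpl. rewrite Hk.
  replace ((-1) ^ n * (exp (y * - t) * ((-1) ^ n * t ^ n)))
    with (((-1) ^ n * (-1) ^ n) * (exp (y * - t) * t ^ n)) by ring.
  rewrite H1. ring.
Qed.

Lemma is_pint_sum (f : nat -> R -> R) (l : nat -> R) (N : nat) :
  (forall n, is_pint (f n) (l n)) ->
  is_pint (fun t => sum_f_R0 (fun n => f n t) N) (sum_f_R0 l N).
Proof.
  intros H. induction N as [|N IH]; simpl; auto. now apply is_pint_plus.
Qed.

(** The transform of [B_r^(l) t^(r-1) / r!]. The term [r = 0] is absent because [bern_quot]
    subtracts the constant term 1. *)
Definition watson_term (l r : nat) (y : R) : R :=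
  match r with O => 0 | S _ => norlund l r / (INR r * y ^ r) end.

Lemma laplace_bern_quot_asymptotic (l N : nat) :
  exists C, forall y, 0 < y ->
    Rabs (laplace (bern_quot l) y - sum_f_R0 (fun r => watson_term l r y) N)
    <= C / y ^ S N.
Proof.
  destruct (norlund_taylor l N) as [C HC].
  exists (C * INR (fact N)). intros y Hy.
  set (c := fun r => norlund l r / INR (fact r)).
  (* Taylor terms of [beta^l - 1] divided by [t]; the remainder becomes [C t^N], whose transform is
     [C N! / y^(N+1)]. *)
  set (q := fun r t => match r with O => 0 | S p => c r * t ^ p end).
  assert (Hq : forall r, is_pint (fun t => exp (y * - t) * q r t) (watson_term l r y)).
  { intros [|p].
    - apply (is_pint_ext (fun t => 0 * exp (- (y * t)))).
      + intros t _. simpl. ring.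
      + replace (watson_term l 0 y) with (0 * / y) by (simpl; ring).
        exact (is_pint_scal 0 _ _ (is_pint_exp y Hy)).
    - apply (is_pint_ext (fun t => c (S p) * (exp (y * - t) * t ^ p))).
      + intros t _. simpl. ring.
      + replace (watson_term l (S p) y) with (c (S p) * (INR (fact p) / y ^ S p)).
        * exact (is_pint_scal _ _ _ (is_pint_laplace_pow p y Hy)).
        * unfold watson_term, c. change (fact (S p)) with (S p * fact p)%nat.
          rewrite mult_INR. pose proof (INR_fact_neq_0 p).
          pose proof (not_0_INR (S p) ltac:(lia)).
          assert (y ^ S p <> 0) by (apply pow_nonzero; lra).
          field. auto. }
  assert (Hsum : forall t, sum_f_R0 (fun r => exp (y * - t) * q r t) N
                           = exp (y * - t) * sum_f_R0 (fun r => q r t) N).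
  { intros t. rewrite scal_sum. apply sum_eq. intros; ring. }
  assert (Hqt : forall t, sum_f_R0 (fun m => c m * t ^ m) N
                          = 1 + t * sum_f_R0 (fun r => q r t) N).
  { intros t. rewrite scal_sum. clear HC Hsum.
    induction N as [|N IH].
    - simpl. unfold c. rewrite norlund_0. simpl. field.
    - rewrite !tech5, IH. simpl. ring. }
  replace (C * INR (fact N) / y ^ S N) with (C * (INR (fact N) / y ^ S N))
    by (unfold Rdiv; ring).
  eapply (is_pint_abs_le _ _ _ _); cycle 1.
  - apply is_pint_minus; [apply (is_pint_laplace _ y (laplaceable_bern_quot l) Hy)|].
    apply is_pint_sum, Hq.
  - exact (is_pint_scal C _ _ (is_pint_laplace_pow N y Hy)).
  - intros t Ht. cbv beta. rewrite Hsum, <- Rmult_minus_distr_l, Rabs_mult.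
    rewrite (Rabs_right (exp _)) by (apply Rle_ge, Rlt_le, exp_pos).
    replace (C * (exp (y * - t) * t ^ N)) with (exp (y * - t) * (C * t ^ N)) by ring.
    apply Rmult_le_compat_l; [apply Rlt_le, exp_pos|].
    specialize (HC t Ht). fold (c) in HC.
    change (fun m => norlund l m / INR (fact m) * t ^ m) with (fun m => c m * t ^ m) in HC.
    rewrite Hqt in HC.
    unfold bern_quot. set (s := sum_f_R0 (fun r => q r t) N) in *.
    replace (bern_gen t ^ l - (1 + t * s)) with (t * ((bern_gen t ^ l - 1) / t - s)) in HC
      by (field; lra).
    rewrite Rabs_mult, (Rabs_right t) in HC by lra.
    apply (Rmult_le_reg_l t); auto. simpl in HC. lra.
Qed.

(** * Expansions at the origin *)

Definition bigO (N : nat) (f : R -> R) : Prop :=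
  exists K delta, 0 < delta /\ forall z, 0 < z < delta -> Rabs (f z) <= K * z ^ N.

Lemma bigO_ext (N : nat) (f g : R -> R) (d : R) :
  0 < d -> (forall z, 0 < z < d -> f z = g z) -> bigO N f -> bigO N g.
Proof.
  intros Hd H (K & delta & Hdelta & HK).
  exists K, (Rmin d delta). split; [now apply Rmin_pos|].
  intros z Hz. pose proof (Rmin_l d delta). pose proof (Rmin_r d delta).
  rewrite <- H by lra. apply HK. lra.
Qed.

Lemma bigO_plus (N : nat) (f g : R -> R) :
  bigO N f -> bigO N g -> bigO N (fun z => f z + g z).
Proof.
  intros (K & d & Hd & HK) (K' & d' & Hd' & HK').
  exists (K + K'), (Rmin d d'). split; [now apply Rmin_pos|].
  intros z Hz. pose proof (Rmin_l d d'). pose proof (Rmin_r d d').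
  eapply Rle_trans; [apply Rabs_triang|]. rewrite Rmult_plus_distr_r.
  apply Rplus_le_compat; [apply HK | apply HK']; lra.
Qed.

Lemma bigO_mul_bounded (N : nat) (f h : R -> R) (M d : R) :
  0 < d -> (forall z, 0 < z < d -> Rabs (h z) <= M) -> bigO N f ->
  bigO N (fun z => h z * f z).
Proof.
  intros Hd Hh (K & d' & Hd' & HK).
  exists (M * K), (Rmin d d'). split; [now apply Rmin_pos|].
  intros z Hz. pose proof (Rmin_l d d'). pose proof (Rmin_r d d').
  rewrite Rabs_mult, Rmult_assoc.
  apply Rmult_le_compat; try apply Rabs_pos; [apply Hh | apply HK]; lra.
Qed.

Lemma bigO_scal (N : nat) (c : R) (f : R -> R) : bigO N f -> bigO N (fun z => c * f z).
Proof.
  apply (bigO_mul_bounded N f (fun _ => c) (Rabs c) 1); [lra|]. intros; lra.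
Qed.

Lemma bigO_sum (N M : nat) (f : nat -> R -> R) :
  (forall r, (r <= M)%nat -> bigO N (f r)) ->
  bigO N (fun z => sum_f_R0 (fun r => f r z) M).
Proof.
  induction M as [|M IH]; intros H; simpl; auto.
  apply bigO_plus; auto.
Qed.

Lemma bigO_pow_mul (N r : nat) (f : R -> R) :
  bigO N f -> bigO (r + N) (fun z => z ^ r * f z).
Proof.
  intros (K & d & Hd & HK). exists K, d. split; auto. intros z Hz.
  rewrite Rabs_mult, (Rabs_right (z ^ r)) by (apply Rle_ge, pow_le; lra).
  rewrite pow_add. replace (K * (z ^ r * z ^ N)) with (z ^ r * (K * z ^ N)) by ring.
  apply Rmult_le_compat_l; auto. apply pow_le; lra.
Qed.

Lemma bigO_pow (N : nat) : bigO N (fun z => z ^ N).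
Proof.
  exists 1, 1. split; [lra|]. intros z Hz.
  rewrite Rabs_right by (apply Rle_ge, pow_le; lra). lra.
Qed.

Lemma Rabs_inv_one_sub (z : R) : 0 < z < / 2 -> Rabs (/ (1 - z)) <= 2.
Proof.
  intros Hz. rewrite Rabs_right by (apply Rle_ge, Rlt_le, Rinv_0_lt_compat; lra).
  replace 2 with (/ / 2) by field. apply Rinv_le_contravar; lra.
Qed.

Lemma C_n_0 (n : nat) : Binomial.C n 0 = 1.
Proof.
  unfold Binomial.C. rewrite Nat.sub_0_r. simpl. field. apply INR_fact_neq_0.
Qed.

Lemma C_n_n (n : nat) : Binomial.C n n = 1.
Proof.
  unfold Binomial.C. rewrite Nat.sub_diag. simpl. field. apply INR_fact_neq_0.
Qed.

(** Pascal's rule telescopes: multiplication by [1 - z] lowers the exponent of the series, up to one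
    boundary term of order [K + 1]. *)
Lemma negbinomial_partial_succ (m K : nat) (z : R) :
  (1 - z) * sum_f_R0 (fun k => Binomial.C (S m + k) (S m) * z ^ k) K
  = sum_f_R0 (fun k => Binomial.C (m + k) m * z ^ k) K
    - Binomial.C (S m + K) (S m) * z ^ S K.
Proof.
  induction K as [|K IH].
  - simpl sum_f_R0. rewrite !Nat.add_0_r, !C_n_n. simpl. ring.
  - rewrite !tech5, Rmult_plus_distr_l, IH.
    rewrite <- !tech_pow_Rmult.
    replace (Binomial.C (S m + S K) (S m))
      with (Binomial.C (m + S K) m + Binomial.C (S m + K) (S m)).
    + ring.
    + replace (S m + K)%nat with (m + S K)%nat by lia.
      replace (S m + S K)%nat with (S (m + S K)) by lia.
      apply pascal. lia.
Qed.

Lemma negbinomial_expansion (m K : nat) :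
  bigO (S K) (fun z => / (1 - z) ^ S m
                       - sum_f_R0 (fun k => Binomial.C (m + k) m * z ^ k) K).
Proof.
  induction m as [|m IH].
  - apply (bigO_ext _ (fun z => / (1 - z) * z ^ S K) _ (/ 2)); [lra| |].
    + intros z Hz.
      rewrite (sum_eq _ (fun k => z ^ k)).
      2: { intros i _. simpl. rewrite C_n_0. ring. }
      rewrite tech3 by lra. simpl. field. lra.
    + apply (bigO_mul_bounded _ _ _ 2 (/ 2)); [lra|exact Rabs_inv_one_sub|apply bigO_pow].
  - apply (bigO_ext _ (fun z => / (1 - z) *
      ((/ (1 - z) ^ S m - sum_f_R0 (fun k => Binomial.C (m + k) m * z ^ k) K)
       + Binomial.C (S m + K) (S m) * z ^ S K)) _ (/ 2)); [lra| |].
    + intros z Hz. pose proof (negbinomial_partial_succ m K z) as H.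
      set (s := sum_f_R0 (fun k => Binomial.C (S m + k) (S m) * z ^ k) K) in *.
      set (s' := sum_f_R0 (fun k => Binomial.C (m + k) m * z ^ k) K) in *.
      replace s' with ((1 - z) * s + Binomial.C (S m + K) (S m) * z ^ S K) by lra.
      rewrite <- (tech_pow_Rmult (1 - z) (S m)).
      assert ((1 - z) ^ S m <> 0) by (apply pow_nonzero; lra).
      field. split; auto. lra.
    + apply (bigO_mul_bounded _ _ _ 2 (/ 2)); [lra|exact Rabs_inv_one_sub|].
      apply bigO_plus; auto. apply bigO_scal, bigO_pow.
Qed.

(** The remainder vanishes at 0 and has derivative [s^N / (1 - s)], at most [2 s^N] up to 1/2; the
    mean value theorem concludes. *)
Lemma ln_one_sub_expansion (N : nat) :
  bigO (S N) (fun z => - ln (1 - z)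
    - sum_f_R0 (fun n => match n with O => 0 | S _ => z ^ n / INR n end) N).
Proof.
  exists 2, (/ 2). split; [lra|]. intros z Hz.
  set (h := fun s => - ln (1 - s)
    - sum_f_R0 (fun n => match n with O => 0 | S _ => s ^ n / INR n end) N).
  assert (Hd : forall s, 0 <= s < 1 -> is_derive h s (s ^ N / (1 - s))).
  { intros s Hs. unfold h. clear h. induction N as [|N IH].
    - simpl. auto_derive; [lra|]. field. lra.
    - apply (is_derive_ext (fun s => (- ln (1 - s)
        - sum_f_R0 (fun n => match n with O => 0 | S _ => s ^ n / INR n end) N)
        - s ^ S N / INR (S N))).
      { intros t. rewrite tech5. simpl. unfold minus, plus, opp; simpl.
        unfold Rminus. rewrite Ropp_plus_distr. now rewrite <- Rplus_assoc. }
      replace (s ^ S N / (1 - s)) with (s ^ N / (1 - s) - s ^ N)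
        by (simpl; field; lra).
      apply (is_derive_minus (fun s => - ln (1 - s)
        - sum_f_R0 (fun n => match n with O => 0 | S _ => s ^ n / INR n end) N)
        (fun s => s ^ S N / INR (S N))); auto.
      replace (s ^ N) with (INR (S N) * 1 * s ^ pred (S N) * / INR (S N)).
      2: { simpl pred. field. apply not_0_INR. lia. }
      apply (is_derive_ext (fun s => / INR (S N) * s ^ S N)).
      { intros; apply Rmult_comm. }
      rewrite Rmult_comm.
      apply (is_derive_scal (fun s => s ^ S N)).
      apply (is_derive_pow (fun s => s)). apply (is_derive_id s). }
  assert (Hh0 : h 0 = 0).
  { unfold h. rewrite (sum_eq _ (fun _ => 0)).
    - rewrite sum_eq_R0 by auto. rewrite !Rminus_0_r, ln_1. ring.
    - intros [|n] _; auto. simpl. unfold Rdiv. ring. }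
  destruct (MVT_gen h 0 z (fun s => s ^ N / (1 - s))) as (c & Hc & Heq).
  { rewrite Rmin_left, Rmax_right by lra. intros x Hx. apply Hd. lra. }
  { rewrite Rmin_left, Rmax_right by lra. intros x Hx.
    apply continuity_pt_filterlim. apply (ex_derive_continuous h).
    eexists. apply Hd. lra. }
  rewrite Rmin_left, Rmax_right in Hc by lra.
  rewrite Hh0, !Rminus_0_r in Heq. fold (h z). rewrite Heq.
  assert (Hp : 0 <= c ^ N <= z ^ N).
  { split; [apply pow_le; lra | apply pow_incr; lra]. }
  assert (Hi : 0 < / (1 - c) <= 2).
  { split; [apply Rinv_0_lt_compat; lra|].
    replace 2 with (/ / 2) by field. apply Rinv_le_contravar; lra. }
  unfold Rdiv. rewrite Rabs_right.
  - rewrite <- tech_pow_Rmult.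
    replace (2 * (z * z ^ N)) with (z ^ N * 2 * z) by ring.
    apply Rmult_le_compat_r; [lra|]. apply Rmult_le_compat; lra.
  - apply Rle_ge. repeat apply Rmult_le_pos; lra.
Qed.

(** * Rearranging the double sum of the partial generating function *)

Lemma sum_exchange (f : nat -> nat -> R) (N M : nat) :
  sum_f_R0 (fun n => sum_f_R0 (fun r => f n r) M) N
  = sum_f_R0 (fun r => sum_f_R0 (fun n => f n r) N) M.
Proof.
  induction N as [|N IH]; simpl; auto.
  rewrite IH, <- plus_sum. now apply sum_eq.
Qed.

(** Padding with zeros makes the triangular range [r <= n] a rectangle, where sums can be
    exchanged. *)
Lemma sum_pad_right (f : nat -> R) (n N : nat) :
  (n <= N)%nat ->
  sum_f_R0 f n = sum_f_R0 (fun r => if (r <=? n)%nat then f r else 0) N.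
Proof.
  intros H. induction H as [|N H IH].
  - apply sum_eq. intros i Hi. apply Nat.leb_le in Hi. now rewrite Hi.
  - rewrite tech5, <- IH. assert (Hn : (S N <=? n)%nat = false) by (apply Nat.leb_gt; lia).
    rewrite Hn. ring.
Qed.

Lemma sum_pad_left (f : nat -> R) (r K : nat) :
  sum_f_R0 f K = sum_f_R0 (fun n => if (r <=? n)%nat then f (n - r)%nat else 0) (r + K).
Proof.
  induction K as [|K IH].
  - rewrite Nat.add_0_r. destruct r as [|r]; [reflexivity|].
    rewrite tech5, (sum_eq (fun n => if (S r <=? n)%nat then f (n - S r)%nat else 0)
                      (fun _ => 0)).
    + rewrite (sum_eq_R0 (fun _ => 0)) by auto. rewrite Nat.leb_refl, Nat.sub_diag. simpl. ring.
    + intros i Hi. assert (Hn : (S r <=? i)%nat = false) by (apply Nat.leb_gt; lia).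
      now rewrite Hn.
  - rewrite Nat.add_succ_r, !tech5, IH.
    assert (Hn : (r <=? S (r + K))%nat = true) by (apply Nat.leb_le; lia).
    rewrite Hn. do 2 f_equal. lia.
Qed.

Definition star_term (l n r : nat) : R :=
  Binomial.C (n + r) (2 * r) * norlund l r / INR (n + r).

Lemma FBstar_partial_exchange (l N : nat) (z : R) :
  FBstar_partial l N z
  = sum_f_R0 (fun r => sum_f_R0 (fun n =>
      match n with O => 0 | S _ =>
        if (r <=? n)%nat then star_term l n r * z ^ n else 0 end) N) N.
Proof.
  rewrite <- sum_exchange. unfold FBstar_partial. apply sum_eq.
  intros [|n] Hn.
  - now rewrite sum_eq_R0.
  - unfold norlund_star. rewrite Rmult_comm, scal_sum. rewrite (sum_pad_right _ (S n) N Hn).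
    reflexivity.
Qed.

(** So the column [r = 0] is the series of [- ln (1 - z)]. *)
Lemma star_term_0 (l n : nat) : star_term l n 0 = / INR n.
Proof.
  unfold star_term. rewrite Nat.add_0_r, Nat.mul_0_r, C_n_0, norlund_0.
  unfold Rdiv. ring.
Qed.

(** Absorption: [C(n+r, 2r) / (n+r) = C(n+r-1, 2r-1) / (2r)], taken at [r + 1] and [n = k + r + 1].
    This turns a column into a negative binomial series. *)
Lemma star_term_succ (l r k : nat) :
  star_term l (k + S r) (S r)
  = / 2 * norlund l (S r) / INR (S r) * Binomial.C (S (2 * r) + k) (S (2 * r)).
Proof.
  unfold star_term, Binomial.C.
  replace (k + S r + S r - 2 * S r)%nat with k by lia.
  replace (S (2 * r) + k - S (2 * r))%nat with k by lia.
  replace (k + S r + S r)%nat with (S (S (2 * r) + k)) by lia.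
  replace (2 * S r)%nat with (S (S (2 * r))) by lia.
  set (p := S (2 * r)).
  change (fact (S (p + k))) with (S (p + k) * fact (p + k))%nat.
  change (fact (S p)) with (S p * fact p)%nat. rewrite !mult_INR.
  assert (Hp : INR (S p) = 2 * INR (S r)).
  { unfold p. rewrite !S_INR, mult_INR. simpl. ring. }
  rewrite Hp.
  pose proof (INR_fact_neq_0 p). pose proof (INR_fact_neq_0 k).
  pose proof (not_0_INR (S r) ltac:(lia)). pose proof (not_0_INR (S (p + k)) ltac:(lia)).
  field. auto.
Qed.

Lemma watson_term_expansion (l N r : nat) :
  (S r <= N)%nat ->
  bigO (S N) (fun z => / 2 * watson_term l (S r) (z + / z - 2)
    - sum_f_R0 (fun n => match n with O => 0 | S _ =>
        if (S r <=? n)%nat then star_term l n (S r) * z ^ n else 0 end) N).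
Proof.
  intros Hr.
  set (c := / 2 * norlund l (S r) / INR (S r)).
  set (m := S (2 * r)).
  (* [S m] is [2 (r + 1)]; cutting the series at [N - (r + 1)] loses order [N - r], and the factor
     [z^(r+1)] restores [N + 1]. *)
  apply (bigO_ext _ (fun z => c * (z ^ S r * (/ (1 - z) ^ S m
     - sum_f_R0 (fun k => Binomial.C (m + k) m * z ^ k) (N - S r)))) _ (/ 2)); [lra| |].
  - intros z Hz. rewrite Rmult_minus_distr_l, Rmult_minus_distr_l. f_equal.
    + unfold watson_term, c.
      replace (z + / z - 2) with ((1 - z) ^ 2 / z) by (field; lra).
      replace (S m) with (2 * S r)%nat by (unfold m; lia).
      rewrite pow_mult. unfold Rdiv. rewrite (Rpow_mult_distr _ (/ z)), pow_inv.
      assert (z ^ S r <> 0) by (apply pow_nonzero; lra).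
      assert (((1 - z) ^ 2) ^ S r <> 0) by (apply pow_nonzero, pow_nonzero; lra).
      pose proof (not_0_INR (S r) ltac:(lia)).
      set (A := ((1 - z) ^ 2) ^ S r) in *. set (B := z ^ S r) in *.
      field. auto.
    + rewrite !scal_sum, (sum_pad_left _ (S r)).
      replace (S r + (N - S r))%nat with N by lia.
      apply sum_eq. intros [|n] _; [reflexivity|].
      destruct (S r <=? S n)%nat eqn:E; [|reflexivity].
      apply Nat.leb_le in E.
      pose proof (star_term_succ l r (S n - S r)) as Hs.
      replace (S n - S r + S r)%nat with (S n) in Hs by lia.
      rewrite Hs. fold m c.
      replace (z ^ S n) with (z ^ (S n - S r) * z ^ S r)
        by (rewrite <- pow_add; f_equal; lia).
      ring.
  - apply bigO_scal. replace (S N) with (S r + S (N - S r))%nat by lia.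
    apply bigO_pow_mul, negbinomial_expansion.
Qed.

Lemma watson_remainder (l N : nat) :
  bigO (S N) (fun z => laplace (bern_quot l) (z + / z - 2)
                - sum_f_R0 (fun r => watson_term l r (z + / z - 2)) N).
Proof.
  destruct (laplace_bern_quot_asymptotic l N) as [C HC].
  (* For [z < 1/2], [1/y = z / (1 - z)^2 <= 4 z]. *)
  exists (Rabs C * 4 ^ S N), (/ 2). split; [lra|]. intros z Hz.
  replace (z + / z - 2) with ((1 - z) ^ 2 / z) by (field; lra).
  set (y := (1 - z) ^ 2 / z).
  assert (Hy : 0 < y) by (apply Rdiv_lt_0_compat; [apply pow_lt|]; lra).
  eapply Rle_trans; [apply HC; auto|].
  assert (Hiy : 0 < / y <= 4 * z).
  { split; [now apply Rinv_0_lt_compat|]. unfold y.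
    replace (/ ((1 - z) ^ 2 / z)) with (z / (1 - z) ^ 2)
      by (field; split; [lra | lra]).
    apply Rle_div_l; [apply pow_lt; lra|].
    assert (/ 4 <= (1 - z) ^ 2) by nra. nra. }
  unfold Rdiv. rewrite <- pow_inv.
  rewrite Rmult_assoc, <- Rpow_mult_distr.
  assert (0 <= (/ y) ^ S N <= (4 * z) ^ S N).
  { split; [apply pow_le; lra | apply pow_incr; lra]. }
  pose proof (Rle_abs C). pose proof (Rabs_pos C). nra.
Qed.

(* The formal series sum_{n>=1} B_n^(l)* z^n is the asymptotic expansion of
   the right-hand side as z -> 0+: for every order N the remainder is
   O(z^(N+1)). *)
Theorem theorem1p2 (l : nat) (hl : (1 <= l)%nat) :
  forall N : nat, exists K : R, exists delta : R, 0 < delta /\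
    forall z : R, 0 < z < delta ->
      Rabs (FBstar_rhs l z - FBstar_partial l N z) <= K * z ^ (N + 1).
Proof.
  intros N. replace (N + 1)%nat with (S N) by lia.
  change (bigO (S N) (fun z => FBstar_rhs l z - FBstar_partial l N z)).
  (* The logarithm is placed in column 0, so that the error can be estimated column by column. *)
  set (lg := fun z r => match r with O => - ln (1 - z) | S _ => 0 end).
  set (S' := fun z r => sum_f_R0 (fun n =>
      match n with O => 0 | S _ =>
        if (r <=? n)%nat then star_term l n r * z ^ n else 0 end) N).
  apply (bigO_ext _ (fun z =>
    / 2 * (laplace (bern_quot l) (z + / z - 2)
           - sum_f_R0 (fun r => watson_term l r (z + / z - 2)) N)
    + sum_f_R0 (fun r => lg z r + / 2 * watson_term l r (z + / z - 2) - S' z r) N)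
    (* [z < 1/4] gives [z + 1/z - 2 > 1], the range of [FBstar_rhs_laplace]. *)
    _ (/ 4)); [lra| |].
  - intros z Hz.
    assert (Hiz : 4 < / z).
    { replace 4 with (/ / 4) by field. apply Rinv_lt_contravar; lra. }
    rewrite FBstar_rhs_laplace by (auto; lra).
    rewrite FBstar_partial_exchange. fold (S' z).
    rewrite minus_sum, plus_sum.
    rewrite (sum_eq (fun r => / 2 * watson_term l r (z + / z - 2))
               (fun r => watson_term l r (z + / z - 2) * / 2)) by (intros; ring).
    rewrite <- scal_sum.
    assert (Hlg : sum_f_R0 (lg z) N = - ln (1 - z)).
    { clear. induction N as [|N IH]; [reflexivity|]. rewrite tech5, IH. simpl. ring. }
    assert (Hln : ln z + ln (z + / z - 2) = 2 * ln (1 - z)).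
    { rewrite <- ln_mult by lra. replace (z * (z + / z - 2)) with ((1 - z) * (1 - z))
        by (field; lra).
      rewrite ln_mult by lra. ring. }
    change (fun r => lg z r) with (lg z). rewrite Hlg, Hln.
    change (fun r => S' z r) with (S' z). field.
  - apply bigO_plus; [apply bigO_scal, watson_remainder|].
    apply bigO_sum. intros [|r] Hr.
    + apply (bigO_ext _ (fun z => - ln (1 - z)
        - sum_f_R0 (fun n => match n with O => 0 | S _ => z ^ n / INR n end) N) _ 1);
        [lra| |apply ln_one_sub_expansion].
      intros z _. unfold lg, S', watson_term. rewrite Rmult_0_r, Rplus_0_r.
      f_equal. apply sum_eq. intros [|n] _; [reflexivity|].
      simpl Nat.leb. cbv iota. rewrite star_term_0. unfold Rdiv. ring.
    + apply (bigO_ext _ (fun z => / 2 * watson_term l (S r) (z + / z - 2) - S' z (S r))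
               _ 1); [lra| |now apply watson_term_expansion].
      intros z _. simpl lg. ring.
Qed.
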